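(* (The statement is to be read either with all words in parentheses included, for a completely contractive Banach algebra $A$, or with all of them omitted, for a Banach algebra $A$.) Every (operator) homogeneous left dual Banach algebra over $A$ is equivalent to a unique (operator) homogeneous left Arens product algebra over $A$. That is, for every (operator) HLDBA $(\mathfrak A,\eta_{\mathfrak A})$ over $A$ there is exactly one (operator) left introverted homogeneous subspace $(\mathcal S(A^* ),\|\cdot\|_{\mathcal S})$ of $A^*$ such that $(\mathfrak A,\eta_{\mathfrak A})\cong(\mathcal S(A^* )^*,\eta_{\mathcal S})$.
   Context: A bilinear map $m:X\times Y\to Z$ of operator spaces is completely contractive (c.c.) if $\|[m(x_{ij},y_{kl})]\|_{M_{rs}(Z)}\le\|[x_{ij}]\|_{M_r(X)}\|[y_{kl}]\|_{M_s(Y)}$ for all $r,s$ and all matrices. A c.c. Banach algebra is an associative algebra that is a (complete) operator space with c.c. multiplication. Right action on $A^*$: $\langle\phi\cdot a,b\rangle=\langle\phi,ab\rangle$. Left introverted homogeneous subspaces. An (operator) left introverted homogeneous subspace of $A^*$ is a pair $(\mathcal S(A^* ),\|\cdot\|_{\mathcal S})$, with $\mathcal S(A^* )$ a linear subspace of $A^*$ and $\|\cdot\|_{\mathcal S}$ a complete (operator space matrix) norm on it, such that (i) $\mathcal S(A^* )\hookrightarrow A^*$ is a (complete) contraction; (ii) $\mathcal S(A^* )$ is a right $A$-submodule of $A^*$ and $(\phi,a)\mapsto\phi\cdot a$, $\mathcal S(A^* )\times A\to\mathcal S(A^* )$, is (completely) contractive for $\|\cdot\|_{\mathcal S}$; (iii)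 for $\mu\in\mathcal S(A^* )^*$ (dual for $\|\cdot\|_{\mathcal S}$) and $\phi\in\mathcal S(A^* )$, the functional $\mu\,\square\,\phi\in A^*$, $\langle\mu\,\square\,\phi,a\rangle=\langle\mu,\phi\cdot a\rangle$, lies in $\mathcal S(A^* )$, and $(\mu,\phi)\mapsto\mu\,\square\,\phi$, $\mathcal S(A^* )^*\times\mathcal S(A^* )\to\mathcal S(A^* )$, is (completely) contractive. Then $\mathcal S(A^* )^*$ is a (c.c.) Banach algebra under $\langle\mu\,\square\,\nu,\phi\rangle=\langle\mu,\nu\,\square\,\phi\rangle$, called an (operator) homogeneous left Arens product algebra over $A$; put $\eta_{\mathcal S}:A\to\mathcal S(A^* )^*$, $\langle\eta_{\mathcal S}(a),\phi\rangle=\langle\phi,a\rangle$. HLDBAs. Let $\mathfrak A$ be a (c.c.) Banach algebra with a fixed (operator space) predual $\mathfrak A_*$, so $\mathfrak A=(\mathfrak A_* )^*$. The pair $(\mathfrak A,\eta_{\mathfrak A})$ is an (operator) homogeneous left dual Banach algebra ((operator) HLDBA) over $A$ if (i) for each $\nu\in\mathfrak A$, $\mu\mapsto\mu\nu$ is weak$^*$-weak$^*$ continuous on $\mathfrak A$; (ii) $\eta_{\mathfrak A}:A\to\mathfrak A$ is a (completely) contractive homomorphism with weak$^*$-dense range whose range is contained in $Z_t(\mathfrak A)=\{\mu\in\mathfrak A:\nu\mapsto\mu\nu\text{ is weak}^*\text{-weak}^*\text{ continuous on }\mathfrak A\}$. Two (operator) HLDBAs over $A$ are equivalent, $(\mathfrak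 A,\eta_{\mathfrak A})\cong(\mathfrak B,\eta_{\mathfrak B})$, if there is a weak$^*$-weak$^*$ continuous surjective (completely) isometric algebra isomorphism $\Phi:\mathfrak A\to\mathfrak B$ with $\Phi\circ\eta_{\mathfrak A}=\eta_{\mathfrak B}$. *)

(* Defs.v *)
(* Scalars are the complex numbers R[i] over an arbitrary R : realType; norms of
   normedModType R[i] are R[i]-valued (with values in the nonnegative reals),
   matrix norms are R-valued. *)
From HB Require Import structures.
From mathcomp Require Import all_boot all_order all_algebra.
From mathcomp Require Import complex mxtens.
From mathcomp Require Import all_classical all_reals all_analysis.

Set Implicit Arguments.
Unset Strict Implicit.
Unset Printing Implicit Defensive.

Import Order.TTheory GRing.Theory Num.Theory.
Import numFieldNormedType.Exports.

Local Open Scope classical_set_scope.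
Local Open Scope ring_scope.
Local Open Scope complex_scope.

Definition rnorm (R : realType) (X : normedModType R[i]) (x : X) : R :=
  complex.Re `|x|.

Lemma rnormE (R : realType) (X : normedModType R[i]) (x : X) :
  `|x| = (rnorm x)%:C.
Proof. by rewrite /rnorm RRe_real// ger0_real. Qed.

Section Dual.
Variables (R : realType) (X : normedModType R[i]).

Definition is_functional : {pred X -> R[i]^o} :=
  fun f => `[< linear f /\ continuous f >].

Record dual := Dual { dual_fun :> X -> R[i]^o; _ : dual_fun \in is_functional }.

HB.instance Definition _ := [isSub for dual_fun].
HB.instance Definition _ := [Choice of dual by <:].

Lemma is_functional_submod : submod_closed is_functional.
Proof.
split=> [|a f g].
  apply/asboolP; split; first by move=> k x y; rewrite scaler0 addr0.
  exact: cst_continuous.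
move=> /asboolP[lf cf] /asboolP[lg cg]; apply/asboolP; split.
  have aux (k x y z t : R[i]) :
      a * (k * x + y) + (k * z + t) = k * (a * x + z) + (a * y + t).
    rewrite !mulrDr !mulrA (mulrC a k) -!addrA; congr (_ + _).
    by rewrite addrCA.
  move=> k x y; rewrite [LHS]/(a *: f (k *: x + y) + g (k *: x + y)) lf lg.
  exact: aux.
by move=> x; apply: cvgD; [apply: cvgZl_tmp; exact: cf|exact: cg].
Qed.
HB.instance Definition _ := GRing.isSubmodClosed.Build R[i] (X -> R[i]^o)
  is_functional is_functional_submod.
HB.instance Definition _ := [SubChoice_isSubLmodule of dual by <:].

Lemma dual_ext (f g : dual) : (forall x, f x = g x) -> f = g.
Proof. by move=> fg; apply/val_inj/funext. Qed.

Lemma dual_linear (f : dual) : linear f.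
Proof. by case: f => f /= /asboolP[]. Qed.

Lemma dual_continuous (f : dual) : continuous f.
Proof. by case: f => f /= /asboolP[]. Qed.

Lemma dualDE (f g : dual) x : (f + g) x = f x + g x. Proof. by []. Qed.
Lemma dualZE a (f : dual) x : (a *: f) x = a *: f x. Proof. by []. Qed.

Let lin (f : X -> R[i]^o) (lf : linear f) : {linear X -> R[i]^o} :=
  HB.pack f (GRing.isLinear.Build _ _ _ _ _ lf).

Lemma dual0E (f : dual) : f 0 = 0.
Proof. exact: (linear0 (lin (dual_linear f))). Qed.

Lemma bounded_is_functional (f : X -> R[i]^o) (M : R[i]) : 0 <= M ->
  linear f -> (forall x, `|f x| <= M * `|x|) -> f \in is_functional.
Proof.
move=> M0 lf fM; apply/asboolP; split=> //.
apply: (@bounded_linear_continuous _ _ _ (lin lf)).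
apply/ex_bound; exists M; apply/nbhs_norm0P; exists 1 => //= x /= /ltW x1.
by apply: (le_trans (fM x)); rewrite ler_piMr.
Qed.

Lemma dual_bounded (f : dual) :
  exists2 M : R, 0 <= M & forall x, rnorm (f x) <= M * rnorm x.
Proof.
have lf := dual_linear f.
have /linear_bounded_continuous/linear_boundedP : continuous (lin lf).
  exact: dual_continuous.
move=> /pinfty_ex_gt0[M M0 fM]; exists (complex.Re M).
  by move: M0; rewrite ltcE => /andP[_ /ltW].
move=> x; have := fM x; rewrite !rnormE -[M]RRe_real ?gtr0_real//.
by rewrite -rmorphM/= lecR.
Qed.

(* |f| is the supremum of |f x| over the closed unit ball. *)
Definition opnorm_set (f : dual) : set R :=
  [set rnorm (f x) | x in [set x | rnorm x <= 1]].

Definition dual_norm (f : dual) : R[i] := (sup (opnorm_set f))%:C.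

Lemma opnorm_set_has_sup f : has_sup (opnorm_set f).
Proof.
split; first by exists (rnorm (f 0)), 0 => //=; rewrite /rnorm normr0.
have [M M0 fM] := dual_bounded f; exists M => _ [x /= x1 <-].
by apply: (le_trans (fM x)); rewrite ler_piMr.
Qed.

Lemma rnorm_ge0 (Y : normedModType R[i]) (y : Y) : 0 <= rnorm y.
Proof. by rewrite -ler0c -rnormE. Qed.

Lemma rnormZ (Y : normedModType R[i]) (k : R[i]) (y : Y) :
  rnorm (k *: y) = rnorm (k : R[i]^o) * rnorm y.
Proof. by apply: complexI; rewrite rmorphM/= -!rnormE normrZ. Qed.

Lemma dual_bound (f : dual) x : rnorm (f x) <= sup (opnorm_set f) * rnorm x.
Proof.
have [x0|x0] := eqVneq x 0.
  rewrite x0; have [M M0 fM] := dual_bounded f; apply: (le_trans (fM 0)).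
  by rewrite /rnorm normr0 !mulr0.
have nx : 0 < rnorm x by rewrite -ltcR -rnormE normr_gt0.
rewrite -ler_pdivrMr//; apply: ub_le_sup; first exact: (opnorm_set_has_sup f).2.
have nV : rnorm ((rnorm x)^-1%:C : R[i]^o) = (rnorm x)^-1.
  apply: complexI; rewrite -rnormE ger0_norm// ler0c invr_ge0 ltW//.
exists ((rnorm x)^-1%:C *: x) => /=; first by rewrite rnormZ nV mulVf ?gt_eqF.
have /(_ (rnorm x)^-1%:C x 0) := dual_linear f.
by rewrite dual0E !addr0 => ->; rewrite rnormZ nV mulrC.
Qed.

Lemma dual_norm_le (f : dual) (M : R) :
  (forall x, rnorm x <= 1 -> rnorm (f x) <= M) -> sup (opnorm_set f) <= M.
Proof.
by move=> fM; apply: ge_sup; [exact: (opnorm_set_has_sup f).1|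
  move=> _ [x /= x1 <-]; exact: fM].
Qed.

Lemma dual_norm_ge0 (f : dual) : 0 <= sup (opnorm_set f).
Proof.
apply: (le_trans (rnorm_ge0 (f 0))); apply: ub_le_sup.
  exact: (opnorm_set_has_sup f).2.
by exists 0 => //=; rewrite /rnorm normr0.
Qed.

Lemma dual_normD (f g : dual) : dual_norm (f + g) <= dual_norm f + dual_norm g.
Proof.
rewrite /dual_norm -rmorphD/= lecR; apply: dual_norm_le => x x1.
apply: (@le_trans _ _ (rnorm (f x) + rnorm (g x))).
  by rewrite -lecR rmorphD/= -!rnormE ler_normD.
by apply: lerD; apply: ub_le_sup; [exact: (opnorm_set_has_sup _).2|exists x|
  exact: (opnorm_set_has_sup _).2|exists x].
Qed.

Lemma dual_normZ (k : R[i]) (f : dual) : dual_norm (k *: f) = `|k| * dual_norm f.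
Proof.
rewrite [`|k|](@rnormE _ R[i]^o) /dual_norm -rmorphM/=; congr (_ %:C).
have le_k (a : R[i]) (g : dual) :
    sup (opnorm_set (a *: g)) <= rnorm (a : R[i]^o) * sup (opnorm_set g).
  apply: dual_norm_le => x x1; rewrite [_ x]/(a *: g x) rnormZ.
  rewrite ler_wpM2l ?rnorm_ge0//.
  by apply: ub_le_sup; [exact: (opnorm_set_has_sup _).2|exists x].
apply/eqP; rewrite eq_le le_k/=.
have [->|k0] := eqVneq k 0.
  by rewrite {1}/rnorm normr0 mul0r dual_norm_ge0.
have := le_k k^-1 (k *: f); rewrite scalerA mulVf// scale1r => /(ler_wpM2l _).
move=> /(_ _ (rnorm_ge0 (k : R[i]^o))) /le_trans; apply.
rewrite mulrA -rnormZ/= (_ : _ *: _ = 1) ?/rnorm ?normr1 ?mul1r//.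
by rewrite /GRing.scale/= mulfV.
Qed.

Lemma dual_norm0_eq0 (f : dual) : dual_norm f = 0 -> f = 0.
Proof.
move=> /complexI f0; apply: dual_ext => x; apply/eqP; rewrite -normr_eq0 rnormE.
have := dual_bound f x; rewrite f0 mul0r => fx0.
by apply/eqP; congr (_ %:C); apply/eqP; rewrite eq_le fx0 rnorm_ge0.
Qed.

HB.instance Definition _ := Lmodule_isNormed.Build R[i] dual
  dual_normD dual_normZ dual_norm0_eq0.

Definition mkdual (f : X -> R[i]^o) (M : R[i]) (M0 : 0 <= M) (lf : linear f)
    (fM : forall x, `|f x| <= M * `|x|) : dual :=
  Dual (bounded_is_functional M0 lf fM).

Lemma dual_normE (f : dual) : `|f| = dual_norm f. Proof. by []. Qed.

Lemma ler_dual (f : dual) x : `|f x| <= `|f| * `|x|.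
Proof. by rewrite dual_normE !rnormE -rmorphM/= lecR dual_bound. Qed.

Definition weakstar : Type :=
  initial_topology (fun f : dual => (f : {ptws X -> R[i]^o})).
HB.instance Definition _ := Topological.on weakstar.

End Dual.

Definition weakstar_continuous (R : realType) (X Y : normedModType R[i])
    (T : dual X -> dual Y) : Prop :=
  continuous (T : weakstar X -> weakstar Y).

(* A banachSubspace is a linear subspace of V with a complete norm of its own,
   unrelated a priori to any norm on V. *)
Section Subspace.
Variable R : realType.

Record subspace (V : lmodType R[i]) := Subspace {
  subspace_mem :> {pred V};
  subspace_closed : submod_closed subspace_mem }.

Section SubspaceType.
Variables (V : lmodType R[i]) (U : subspace V).
HB.instance Definition _ := GRing.isSubmodClosed.Build R[i] V
  (subspace_mem U) (subspace_closed U).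

Record subspace_type := SubspaceElt { sval : V; svalP : sval \in U }.
HB.instance Definition _ := [isSub for sval].
HB.instance Definition _ := [Choice of subspace_type by <:].
HB.instance Definition _ := [SubChoice_isSubLmodule of subspace_type by <:].
End SubspaceType.

Record normedSubspace (V : lmodType R[i]) := NormedSubspace {
  ns_sub :> subspace V;
  ns_norm : subspace_type ns_sub -> R[i];
  ns_normD : forall x y, ns_norm (x + y) <= ns_norm x + ns_norm y;
  ns_normZ : forall (k : R[i]) x, ns_norm (k *: x) = `|k| * ns_norm x;
  ns_norm0 : forall x, ns_norm x = 0 -> x = 0 }.

Definition ns_type (V : lmodType R[i]) (N : normedSubspace V) : Type :=
  subspace_type N.

Section NormedSubspaceType.
Variables (V : lmodType R[i]) (N : normedSubspace V).
HB.instance Definition _ := GRing.Lmodule.on (ns_type N).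
HB.instance Definition _ := Lmodule_isNormed.Build R[i] (ns_type N)
  (@ns_normD V N) (@ns_normZ V N) (@ns_norm0 V N).
End NormedSubspaceType.

Record banachSubspace (V : lmodType R[i]) := BanachSubspace {
  bs_ns :> normedSubspace V;
  bs_complete : forall F : set_system (ns_type bs_ns),
    ProperFilter F -> cauchy F -> cvg F }.

Definition bs_type (V : lmodType R[i]) (S : banachSubspace V) : Type :=
  ns_type S.

Section BanachSubspaceType.
Variables (V : lmodType R[i]) (S : banachSubspace V).
HB.instance Definition _ := NormedModule.on (bs_type S).
HB.instance Definition _ := Uniform_isComplete.Build (bs_type S)
  (@bs_complete V S).

Definition bs_val (x : bs_type S) : V := sval x.
Lemma bs_val_inj : injective bs_val.
Proof. exact: val_inj. Qed.
Lemma bs_val_linear : linear bs_val.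
Proof. by []. Qed.
Lemma bs_valP x : bs_val x \in S.
Proof. exact: svalP. Qed.

Definition bs_in (v : V) (vS : v \in S) : bs_type S := SubspaceElt vS.
End BanachSubspaceType.

End Subspace.
Coercion bs_type : banachSubspace >-> Sortclass.

Section Banach.
Variable R : realType.

Definition contractive2 (X Y Z : normedModType R[i]) (m : X -> Y -> Z) : Prop :=
  forall x y, `|m x y| <= `|x| * `|y|.

Record banach_product (X : normedModType R[i]) (m : X -> X -> X) : Prop :=
  BanachProduct {
    bp_linearl : forall y, linear (fun x => m x y);
    bp_linearr : forall x, linear (m x);
    bp_assoc : associative m;
    bp_norm : contractive2 m }.

(* No unit is required. *)
Record banachAlg := BanachAlg {
  ba_space :> completeNormedModType R[i];
  ba_mul : ba_space -> ba_space -> ba_space;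
  ba_mulP : banach_product ba_mul }.

Section OverA.
Variable A : banachAlg.
Local Notation "a *A b" := (@ba_mul A a b) (at level 40).

Lemma dual_act_linear (phi : dual A) (a : A) : linear (fun b => phi (a *A b)).
Proof. by move=> k x y; rewrite (bp_linearr (ba_mulP A)) dual_linear. Qed.

Lemma dual_act_bound (phi : dual A) (a b : A) :
  `|phi (a *A b)| <= (`|phi| * `|a|) * `|b|.
Proof.
apply: (le_trans (ler_dual phi _)); rewrite -mulrA ler_wpM2l//.
exact: (bp_norm (ba_mulP A)).
Qed.

Definition dual_act (phi : dual A) (a : A) : dual A :=
  mkdual (mulr_ge0 (normr_ge0 phi) (normr_ge0 a)) (dual_act_linear phi a)
    (dual_act_bound phi a).

(* Bare data, on which HLDBA is a predicate. The underlying algebra is literally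
   the dual of the predual, so it is automatically complete. *)
Record dualAlgOver := DualAlgOver {
  predual : completeNormedModType R[i];
  dmul : dual predual -> dual predual -> dual predual;
  deta : A -> dual predual }.

Definition top_center (B : dualAlgOver) : set (dual (predual B)) :=
  [set mu | weakstar_continuous (dmul mu)].
Arguments top_center : clear implicits.

Record HLDBA (B : dualAlgOver) : Prop := {
  hl_mul : banach_product (@dmul B);
  hl_mul_cont : forall nu : dual (predual B),
    weakstar_continuous (fun mu => dmul mu nu);
  hl_eta_linear : linear (@deta B);
  hl_eta_mul : forall a b, deta B (a *A b) = dmul (deta B a) (deta B b);
  hl_eta_contr : forall a, `|deta B a| <= `|a|;
  hl_eta_dense : dense (range (@deta B) : set (weakstar (predual B)));
  hl_eta_center : range (@deta B) `<=` top_center B }.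

Record hldba_iso (B C : dualAlgOver) (Phi : dual (predual B) -> dual (predual C))
    : Prop := {
  iso_linear : linear Phi;
  iso_mul : forall mu nu, Phi (dmul mu nu) = dmul (Phi mu) (Phi nu);
  iso_norm : forall mu, `|Phi mu| = `|mu|;
  iso_surj : range Phi = setT;
  iso_cont : weakstar_continuous Phi;
  iso_eta : forall a, Phi (deta B a) = deta C a }.

Definition hldba_equiv (B C : dualAlgOver) : Prop :=
  exists Phi : dual (predual B) -> dual (predual C), hldba_iso Phi.

Section Introverted.
Variable S : banachSubspace (dual A).

(* The right action maps S x A into S; mu square phi maps S^* x S into S. As
   these closure properties and bounds are used to form the next map, they are
   hypotheses of the corresponding definitions. *)
Definition act_closed := forall (phi : S) a, dual_act (bs_val phi) a \in S.

Hypothesis Sact : act_closed.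
Definition sub_act (phi : S) (a : A) : S := bs_in (Sact phi a).

Lemma sub_actE (phi : S) (a b : A) : bs_val (sub_act phi a) b = bs_val phi (a *A b).
Proof. by []. Qed.

Hypothesis Sactn : contractive2 sub_act.

Lemma box_linear (mu : dual S) (phi : S) : linear (fun a => mu (sub_act phi a)).
Proof.
move=> k a b; rewrite -dual_linear; congr (mu _).
apply/val_inj/dual_ext => c; rewrite /= (bp_linearl (ba_mulP A)).
by rewrite dual_linear.
Qed.

Lemma box_bound (mu : dual S) (phi : S) a :
  `|mu (sub_act phi a)| <= (`|mu| * `|phi|) * `|a|.
Proof.
by apply: (le_trans (ler_dual mu _)); rewrite -mulrA ler_wpM2l.
Qed.

Definition box (mu : dual S) (phi : S) : dual A :=
  mkdual (mulr_ge0 (normr_ge0 mu) (normr_ge0 phi)) (box_linear mu phi)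
    (box_bound mu phi).

Definition box_closed := forall mu phi, box mu phi \in S.

Hypothesis Sbox : box_closed.
Definition sub_box (mu : dual S) (phi : S) : S := bs_in (Sbox mu phi).

End Introverted.

Record introverted := Introverted {
  in_space :> banachSubspace (dual A);
  in_contr : forall phi : in_space, `|bs_val phi| <= `|phi|;
  in_act : act_closed in_space;
  in_act_contr : contractive2 (sub_act in_act);
  in_box : box_closed in_act_contr;
  in_box_contr : contractive2 (sub_box in_box) }.

Section Arens.
Variable S : introverted.
Let bx (nu : dual S) (phi : S) : S := sub_box (@in_box S) nu phi.

Lemma arens_linear (mu nu : dual S) : linear (fun phi => mu (bx nu phi)).
Proof.
move=> k x y; rewrite -dual_linear; congr (mu _).
apply: bs_val_inj; rewrite bs_val_linear; apply: dual_ext => a.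
rewrite -[RHS]/(k *: nu (sub_act (@in_act S) x a) + nu (sub_act (@in_act S) y a)).
rewrite -dual_linear; congr (nu _).
apply: bs_val_inj; rewrite bs_val_linear; apply: dual_ext => b.
by rewrite dualDE dualZE !sub_actE bs_val_linear dualDE dualZE.
Qed.

Lemma arens_bound (mu nu : dual S) (phi : S) :
  `|mu (bx nu phi)| <= (`|mu| * `|nu|) * `|phi|.
Proof.
by apply: (le_trans (ler_dual mu _)); rewrite -mulrA ler_wpM2l// in_box_contr.
Qed.

Definition arens (mu nu : dual S) : dual S :=
  mkdual (mulr_ge0 (normr_ge0 mu) (normr_ge0 nu)) (arens_linear mu nu)
    (arens_bound mu nu).

Lemma eta_linear (a : A) : linear (fun phi : S => bs_val phi a).
Proof. by move=> k x y; rewrite bs_val_linear dualDE dualZE. Qed.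

Lemma eta_bound (a : A) (phi : S) : `|bs_val phi a| <= `|a| * `|phi|.
Proof.
apply: (le_trans (ler_dual _ _)); rewrite mulrC ler_wpM2l//; exact: in_contr.
Qed.

Definition arens_eta (a : A) : dual S :=
  mkdual (normr_ge0 a) (eta_linear a) (eta_bound a).

Definition arensAlg : dualAlgOver := DualAlgOver arens arens_eta.
End Arens.

End OverA.
End Banach.

Section Operator.
Variable R : realType.

Definition hnorm n (v : 'cV[R[i]]_n) : R :=
  Num.sqrt (\sum_i (rnorm (v i 0 : R[i]^o)) ^+ 2).

(* The norm of a complex matrix as an operator between Hilbert spaces l^2. *)
Definition mx_opnorm m n (a : 'M[R[i]]_(m, n)) : R :=
  sup [set hnorm (a *m v) | v in [set v | hnorm v <= 1]].

Definition mxnorm (X : Type) := forall n, 'M[X]_n -> R.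

Definition bimodule_mx (X : lmodType R[i]) m n
    (a : 'M[R[i]]_(m, n)) (x : 'M[X]_n) (b : 'M[R[i]]_(n, m)) : 'M[X]_m :=
  \matrix_(i, j) \sum_k \sum_l (a i k * b l j) *: x k l.

(* Ruan's axioms for a matrix norm whose first level is the norm of X. *)
Record opspace (X : normedModType R[i]) (p : mxnorm X) : Prop := {
  os_level1 : forall x : X, (p 1%N (const_mx x))%:C = `|x|;
  os_normD : forall n (x y : 'M[X]_n), p n (x + y) <= p n x + p n y;
  os_normZ : forall n (k : R[i]) (x : 'M[X]_n),
    p n (map_mx (fun y => k *: y) x) = rnorm (k : R[i]^o) * p n x;
  os_norm0 : forall n (x : 'M[X]_n), p n x = 0 -> x = 0;
  os_dsum : forall m n (x : 'M[X]_m) (y : 'M[X]_n),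
    p (m + n)%N (block_mx x 0 0 y) = Num.max (p m x) (p n y);
  os_bimod : forall m n (a : 'M[R[i]]_(m, n)) (x : 'M[X]_n) (b : 'M[R[i]]_(n, m)),
    p m (bimodule_mx a x b) <= mx_opnorm a * p n x * mx_opnorm b }.

(* [m(x_ij, y_kl)], with rows indexed by (i, k) and columns by (j, l). *)
Definition amplify (X Y Z : Type) (m : X -> Y -> Z) r s
    (x : 'M[X]_r) (y : 'M[Y]_s) : 'M[Z]_(r * s) :=
  \matrix_(p, q) m (x (mxtens_unindex p).1 (mxtens_unindex q).1)
                   (y (mxtens_unindex p).2 (mxtens_unindex q).2).

Definition cc (X Y : Type) (p : mxnorm X) (q : mxnorm Y) (f : X -> Y) : Prop :=
  forall n (x : 'M[X]_n), q n (map_mx f x) <= p n x.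

Definition cc2 (X Y Z : Type) (p : mxnorm X) (q : mxnorm Y) (t : mxnorm Z)
    (m : X -> Y -> Z) : Prop :=
  forall r s (x : 'M[X]_r) (y : 'M[Y]_s),
    t (r * s)%N (amplify m x y) <= p r x * q s y.

(* The dual operator space structure M_n(X^* ) = CB(X, M_n): the completely
   bounded norm of x |-> [phi_ij(x)]. *)
Definition dual_mxnorm (X : normedModType R[i]) (p : mxnorm X) : mxnorm (dual X) :=
  fun n phi => sup [set t | exists r (x : 'M[X]_r),
    p r x <= 1 /\ t = mx_opnorm (amplify (fun (f : dual X) y => f y : R[i]) phi x)].

Record ccBanachAlg := CCBanachAlg {
  cc_ba :> banachAlg R;
  cc_mx : mxnorm cc_ba;
  cc_mxP : opspace cc_mx;
  cc_mulP : cc2 cc_mx cc_mx cc_mx (@ba_mul R cc_ba) }.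

Section OverA.
Variable A : ccBanachAlg.

Record opDualAlgOver := OpDualAlgOver {
  op_dual :> dualAlgOver A;
  op_mx : mxnorm (predual op_dual) }.

Definition op_dmx (B : opDualAlgOver) : mxnorm (dual (predual B)) :=
  dual_mxnorm (@op_mx B).

(* The contractivity conditions in HLDBA and introverted are the first levels of
   the completely contractive ones below. *)
Record op_HLDBA (B : opDualAlgOver) : Prop := {
  ohl_HLDBA : HLDBA B;
  ohl_mxP : opspace (@op_mx B);
  ohl_mul : cc2 (@op_dmx B) (@op_dmx B) (@op_dmx B) (@dmul R A B);
  ohl_eta : cc (@cc_mx A) (@op_dmx B) (@deta R A B) }.

Definition op_hldba_equiv (B C : opDualAlgOver) : Prop :=
  exists Phi : dual (predual B) -> dual (predual C), hldba_iso Phi /\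
    forall n (x : 'M[dual (predual B)]_n), op_dmx (map_mx Phi x) = op_dmx x.

Record op_introverted := OpIntroverted {
  oin :> introverted A;
  oin_mx : mxnorm oin;
  oin_mxP : opspace oin_mx;
  oin_contr : cc oin_mx (dual_mxnorm (@cc_mx A)) (@bs_val R _ oin);
  oin_act : cc2 oin_mx (@cc_mx A) oin_mx (sub_act (@in_act R A oin));
  oin_box : cc2 (dual_mxnorm oin_mx) oin_mx oin_mx (sub_box (@in_box R A oin)) }.

Definition op_arensAlg (S : op_introverted) : opDualAlgOver :=
  @OpDualAlgOver (arensAlg S) (@oin_mx S).

End OverA.
End Operator.

(* Leibniz equality of (operator) introverted subspaces is equality of the
   underlying subsets of the dual of A and of the (matrix) norms on them. *)
Section Extensionality.
Variable R : realType.

Lemma banachSubspace_ext (V : lmodType R[i]) (S T : banachSubspace V) :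
  (forall v, (v \in S) = (v \in T)) ->
  (forall (x : S) (y : T), bs_val x = bs_val y -> `|x| = `|y|) -> S = T.
Proof.
case: S => -[[S Sc] nS SD SZ S0] Scp; case: T => -[[T Tc] nT TD TZ T0] Tcp.
move=> ST; have eST : S = T by apply/funext => v; exact: ST.
case: T / eST in Tc nT TD TZ T0 Tcp ST *.
have eTc := Prop_irrelevance Sc Tc; case: Tc / eTc in nT TD TZ T0 Tcp ST *.
move=> nST; have enST : nS = nT by apply/funext => x; exact: (nST x x).
case: nT / enST in TD TZ T0 Tcp ST nST *.
have eD := Prop_irrelevance SD TD; case: TD / eD in Tcp ST nST *.
have eZ := Prop_irrelevance SZ TZ; case: TZ / eZ in Tcp ST nST *.
have e0 := Prop_irrelevance S0 T0; case: T0 / e0 in Tcp ST nST *.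
by rewrite (Prop_irrelevance Tcp Scp).
Qed.

Lemma introverted_ext (A : banachAlg R) (S T : introverted A) :
  (forall phi, (phi \in in_space S) = (phi \in in_space T)) ->
  (forall (x : S) (y : T), bs_val x = bs_val y -> `|x| = `|y|) -> S = T.
Proof.
move=> ST nST; have := banachSubspace_ext ST nST.
move: S T {ST nST} => [S a b c d e] [T a' b' c' d' e'] /= eST.
case: T / eST in a' b' c' d' e' *.
rewrite (Prop_irrelevance a' a).
have eb := Prop_irrelevance b b'; case: b' / eb in c' d' e' *.
have ec := Prop_irrelevance c c'; case: c' / ec in d' e' *.
have ed := Prop_irrelevance d d'; case: d' / ed in e' *.
by rewrite (Prop_irrelevance e' e).
Qed.

Lemma op_introverted_ext (A : ccBanachAlg R) (S T : op_introverted A) :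
  (forall phi, (phi \in in_space S) = (phi \in in_space T)) ->
  (forall n (x : 'M[S]_n) (y : 'M[T]_n),
     map_mx (@bs_val _ _ S) x = map_mx (@bs_val _ _ T) y ->
     oin_mx x = oin_mx y) -> S = T.
Proof.
move=> ST nST; have : oin S = oin T.
  apply: introverted_ext => // x y xy.
  rewrite -(os_level1 (oin_mxP S)) -(os_level1 (oin_mxP T)).
  by congr (_ %:C); apply: nST; apply/matrixP => i j; rewrite !mxE.
move: S T {ST} nST => [S p p1 p2 p3 p4] [T q q1 q2 q3 q4] /= nST eST.
case: T / eST in q q1 q2 q3 q4 nST *.
have epq : p = q.
  by apply: functional_extensionality_dep => n; apply/funext => x; exact: nST.
case: q / epq {nST} in q1 q2 q3 q4 *.
by rewrite (Prop_irrelevance q1 p1) (Prop_irrelevance q2 p2)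
  (Prop_irrelevance q3 p3) (Prop_irrelevance q4 p4).
Qed.

End Extensionality.

(* Main.v *)
Require Import Defs.
From mathcomp Require Import all_boot all_order all_algebra.
From mathcomp Require Import complex mxtens.
From mathcomp Require Import all_classical all_reals all_analysis.
From mathcomp Require Import ring lra.

Set Implicit Arguments.
Unset Strict Implicit.
Unset Printing Implicit Defensive.

Import Order.TTheory GRing.Theory Num.Theory.
Import numFieldNormedType.Exports.

Local Open Scope classical_set_scope.
Local Open Scope ring_scope.
Local Open Scope complex_scope.
Local Open Scope sesquilinear_scope.

(* Let P be the predual of the HLDBA and T : P -> A^* the map
   (T p)(a) = <eta a, p>. Weak* density of the range of eta makes T injective, and
   S is T(P) with the norm (or matrix norms) of P. A weak* continuous functional on
   P^* is evaluation at a point of P, so weak* continuity of mu |-> (eta a) mu and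
   of nu |-> nu mu says that both multiplications have pre-adjoints on P: these are
   the module action and the square action of S. Conversely, an equivalence with
   S^* is the adjoint of an isometry Q : S -> P, onto by Hahn-Banach, and
   compatibility with eta reads s = T (Q s): this determines S and its norm.
   Completely contractive estimates on P itself, as opposed to P^*, need the
   Effros-Ruan theorem that a matrix norm satisfying Ruan's axioms is recovered
   from the dual one (mxnorm_le_dual). *)

(** * Hahn-Banach theorems *)

(** Hahn-Banach is used in the form: below every sublinear functional lies a real-linear one.
    Further demands, such as attaining a value at a point or dominating a whole family of estimates,
    are built into the sublinear functional by taking an infimum, which replaces separation of
    convex sets. The hypotheses bound products in the dual of P, whereas S needs bounds in P. For
    single norms one tests on the unit ball of the dual, where both actions become products in the
    algebra. Scalar functionals on matrices over P do not become such products, but matrices over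
    the dual of P do; hence the appeal to Effros-Ruan. It serves uniqueness as well, since an
    equivalence compares only dual matrix norms. *)

Section LinearMaps.
Variables (K : pzRingType) (V W : lmodType K) (f : V -> W).
Hypothesis lf : linear f.

Lemma linearP_0 : f 0 = 0.
Proof.
by have := lf (-1) 0 0; rewrite !scaleN1r oppr0 addr0 addNr.
Qed.

Lemma linearP_D x y : f (x + y) = f x + f y.
Proof. by have := lf 1 x y; rewrite !scale1r. Qed.

Lemma linearP_Z k x : f (k *: x) = k *: f x.
Proof. by have := lf k x 0; rewrite linearP_0 !addr0. Qed.

Lemma linearP_N x : f (- x) = - f x.
Proof. by rewrite -scaleN1r linearP_Z scaleN1r. Qed.

Lemma linearP_B x y : f (x - y) = f x - f y.
Proof. by rewrite linearP_D linearP_N. Qed.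

Lemma linearP_sum (I : Type) (r : seq I) (P : pred I) (F : I -> V) :
  f (\sum_(i <- r | P i) F i) = \sum_(i <- r | P i) f (F i).
Proof.
by elim/big_rec2: _ => [|i y1 y2 _ <-]; [exact: linearP_0|exact: linearP_D].
Qed.

End LinearMaps.

Section HahnBanach.
Variables (R : realType) (V : lmodType R[i]).

(** One inequality for [t > 0] is easy to verify for an infimum; applied to the inverse of [t] it
    yields the reverse one, and the factors [2] and [1/2] force the value [0] at [0]. *)
Definition sublinear (p : V -> R) :=
  (forall x y, p (x + y) <= p x + p y) /\
  (forall (t : R) x, 0 < t -> p (t%:C *: x) <= t * p x).

Lemma sublinear0 p : sublinear p -> p 0 = 0.
Proof.
move=> [_ pZ]; have := pZ 2^-1 0; have := pZ 2 0.
by rewrite !scaler0 invr_gt0 ltr0n => /(_ isT) ? /(_ isT) ?; lra.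
Qed.

Lemma sublinearZ p (t : R) x : sublinear p -> 0 <= t -> p (t%:C *: x) = t * p x.
Proof.
move=> sp; rewrite le_eqVlt => /orP[/eqP <-|t0].
  by rewrite scale0r (sublinear0 sp) mul0r.
apply/eqP; rewrite eq_le sp.2//=.
have := sp.2 t^-1 (t%:C *: x); rewrite invr_gt0 scalerA -rmorphM/= mulVf ?gt_eqF//.
by rewrite scale1r => /(_ t0); rewrite mulrC ler_pdivlMr// mulrC.
Qed.

Lemma sublinear_ge_opp p x : sublinear p -> - p (- x) <= p x.
Proof.
by move=> sp; have := sp.1 x (- x); rewrite subrr (sublinear0 sp) -lerBlDr sub0r.
Qed.

(** [E x] collects upper bounds for the value at [x]; sums and positive multiples of such bounds
    need only be matched or improved by another bound. *)
Lemma sublinear_inf (E : V -> set R) :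
  (forall x, has_inf (E x)) ->
  (forall x y a b, E x a -> E y b -> exists2 c, E (x + y) c & c <= a + b) ->
  (forall (t : R) x a, 0 < t -> E x a ->
     exists2 c, E (t%:C *: x) c & c <= t * a) ->
  sublinear (fun x => inf (E x)).
Proof.
move=> E0 ED EZ; split=> [x y|t x t0].
  rewrite -lerBlDr; apply: lb_le_inf; first exact: (E0 x).1.
  move=> a Ea; rewrite lerBlDr -lerBlDl; apply: lb_le_inf; first exact: (E0 y).1.
  move=> b Eb; rewrite lerBlDl; have [c Ec] := ED _ _ _ _ Ea Eb.
  by apply: le_trans; apply: ge_inf => //; exact: (E0 _).2.
rewrite -ler_pdivrMl//; apply: lb_le_inf; first exact: (E0 x).1.
move=> a Ea; rewrite ler_pdivrMl//; have [c Ec] := EZ _ _ _ t0 Ea.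
by apply: le_trans; apply: ge_inf => //; exact: (E0 _).2.
Qed.

Lemma chain_sublinear (p : V -> R) (A : set (V -> R)) : A !=set0 ->
  (forall q, A q -> sublinear q /\ forall x, q x <= p x) ->
  (forall q r, A q -> A r -> (forall x, q x <= r x) \/ (forall x, r x <= q x)) ->
  let m x := inf [set q x | q in A] in
  sublinear m /\ forall q, A q -> forall x, m x <= q x.
Proof.
move=> [q0 Aq0] Ap Atot m.
(* Bounded below because [- p (- x) <= - q (- x) <= q x] for each [q] under [p]. *)
have hi x : has_inf [set q x | q in A].
  split; first by exists (q0 x), q0.
  exists (- p (- x)) => _ [q Aq <-]; have [sq qp] := Ap _ Aq.
  by apply: le_trans (sublinear_ge_opp x sq); rewrite lerN2.
split; last by move=> q Aq x; apply: ge_inf; [exact: (hi x).2|exists q].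
apply: sublinear_inf => //.
  (* The smaller of the two comparable members serves at the sum. *)
  move=> x y _ _ [q Aq <-] [r Ar <-]; have [qr|rq] := Atot _ _ Aq Ar.
    exists (q (x + y)); first by exists q.
    by apply: (le_trans ((Ap _ Aq).1.1 x y)); rewrite lerD2l.
  exists (r (x + y)); first by exists r.
  by apply: (le_trans ((Ap _ Ar).1.1 x y)); rewrite lerD2r.
move=> t x _ t0 [q Aq <-]; exists (q (t%:C *: x)); first by exists q.
exact: (Ap _ Aq).1.2.
Qed.

Lemma minimal_sublinear (p : V -> R) : sublinear p ->
  exists q, [/\ sublinear q, forall x, q x <= p x &
    forall r, sublinear r -> (forall x, r x <= q x) -> r = q].
Proof.
move=> sp; pose P (q : V -> R) := sublinear q /\ forall x, q x <= p x.
pose T := {q : V -> R | P q}.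
(* The order is reversed, so that a maximal element for Zorn is a pointwise minimal functional. *)
pose r (s t : T) := `[< forall x, projT1 t x <= projT1 s x >].
have [||||t tmax] := @Zorn T r.
- by move=> t; apply/asboolP.
- move=> u s t /asboolP us /asboolP st; apply/asboolP => x.
  exact: le_trans (us x).
- move=> [s Ps] [t Pt] /asboolP st /asboolP ts; apply/eq_exist/funext => x.
  by apply/eqP; rewrite eq_le st ts.
- move=> A Atot; have [Aa'|A0] := pselect (A !=set0); last first.
    (* The empty chain is bounded by [p] itself. *)
    exists (exist P p (conj sp (fun=> lexx _))) => s As.
    by case: A0; exists s.
  have [|||sm mle] := @chain_sublinear p [set projT1 q | q in A].
  + by case: Aa' => a' ?; exists (projT1 a'), a'.
  + by move=> _ [q _ <-]; exact: (projT2 q).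
  + move=> _ _ [q Aq <-] [s As <-]; case: (Atot _ _ Aq As) => /asboolP H.
      by right.
    by left.
  have mp x : inf [set q x | q in [set projT1 q | q in A]] <= p x.
    case: Aa' => a' Aa'; apply: le_trans ((projT2 a').2 x); apply: mle.
    by exists a'.
  exists (exist P _ (conj sm mp)) => s As; apply/asboolP => x /=.
  by apply: mle; exists s.
exists (projT1 t); split; [exact: (projT2 t).1|exact: (projT2 t).2|].
move=> s ss st.
have sp' x : s x <= p x by apply: le_trans (st x) ((projT2 t).2 x).
by rewrite -(tmax (exist P s (conj ss sp')))//; apply/asboolP.
Qed.

(** The witness is the infimum over [t >= 0] of [p (x + t x0) - t p x0]: [t = 0] gives [r <= p], and
    [t = 1] at [- x0] gives the last bound. A linear functional below [r] is at least [p x0] at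
    [x0], hence attains [p] there. *)
Lemma sublinear_shift (p : V -> R) x0 : sublinear p -> exists r : V -> R,
  [/\ sublinear r, forall x, r x <= p x & r (- x0) <= - p x0].
Proof.
move=> sp; pose E x := [set p (x + t%:C *: x0) - t * p x0 | t in [set t | 0 <= t]].
have hE x : has_inf (E x).
  split; first by exists (p (x + 0%:C *: x0) - 0 * p x0), 0 => /=.
  exists (- p (- x)) => _ [t /= t0 <-]; rewrite lerBrDr -(sublinearZ _ sp)//.
  have := sp.1 (x + t%:C *: x0) (- x); rewrite addrAC subrr add0r.
  by rewrite -lerBlDr addrC.
exists (fun x => inf (E x)); split.
- apply: sublinear_inf => // [x y _ _ [s /= s0 <-] [t /= t0 <-]|s x _ s0 [t /= t0 <-]].
    exists (p ((x + y) + (s + t)%:C *: x0) - (s + t) * p x0).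
      by exists (s + t) => //=; rewrite addr_ge0.
    have := sp.1 (x + s%:C *: x0) (y + t%:C *: x0).
    by rewrite addrACA -scalerDl -rmorphD/=; lra.
  exists (p (s%:C *: x + (s * t)%:C *: x0) - (s * t) * p x0).
    by exists (s * t) => //=; rewrite mulr_ge0// ltW.
  by rewrite mulrBr mulrA lerB// rmorphM/= -scalerA -scalerDr sp.2.
- move=> x; apply: ge_inf; first exact: (hE x).2.
  by exists 0 => //=; rewrite scale0r mul0r addr0 subr0.
apply: ge_inf; first exact: (hE _).2.
by exists 1 => //=; rewrite scale1r addNr (sublinear0 sp) mul1r sub0r.
Qed.

(* A minimal sublinear functional is odd: compare it with its shifts. *)
Lemma hahn_banach (p : V -> R) : sublinear p -> exists f : V -> R,
  [/\ forall x y, f (x + y) = f x + f y,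
      forall (t : R) x, f (t%:C *: x) = t * f x & forall x, f x <= p x].
Proof.
move=> sp; have [q [sq qp qmin]] := minimal_sublinear sp.
have qN x0 : q (- x0) = - q x0.
  have [r [sr rq rx0]] := sublinear_shift x0 sq.
  apply/eqP; rewrite eq_le -{1}(qmin r sr rq) rx0/=.
  by rewrite lerNl sublinear_ge_opp.
exists q; split=> // [x y|t x].
  apply/eqP; rewrite eq_le sq.1/=.
  have := sq.1 (x + y) (- y); rewrite addrK qN; lra.
have [t0|/ltW t0] := leP 0 t; first exact: sublinearZ.
by rewrite -[t in LHS]opprK rmorphN scaleNr qN sublinearZ ?oppr_ge0//; lra.
Qed.

Definition seminorm (p : V -> R) :=
  (forall x y, p (x + y) <= p x + p y) /\
  (forall (k : R[i]) x, p (k *: x) <= rnorm (k : R[i]^o) * p x).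

Lemma rnorm_real (t : R) : 0 <= t -> rnorm (t%:C : R[i]^o) = t.
Proof. by move=> t0; apply: complexI; rewrite -rnormE ger0_norm// ler0c. Qed.

Lemma seminorm_sublinear p : seminorm p -> sublinear p.
Proof. by move=> [pD pZ]; split=> // t x /ltW t0; rewrite -{2}(rnorm_real t0). Qed.

(** A real functional [f] below the shift of [p] at [x0] is complexified to [f x - i f (i x)].
    Multiplying [x] by the conjugate phase of [F x] makes the value real, so a bound on real parts
    bounds the modulus. At [x0] the real part already equals [p x0], which leaves no room for an
    imaginary part. *)
Lemma seminorm_functional (p : V -> R) x0 : seminorm p ->
  exists F : V -> R[i]^o,
    [/\ linear F, forall x, rnorm (F x) <= p x & F x0 = (p x0)%:C].
Proof.
move=> sp; have [r [sr rp rx0]] := sublinear_shift x0 (seminorm_sublinear sp).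
have [f [fD fZ fr]] := hahn_banach sr.
have fp x : f x <= p x by apply: le_trans (rp x).
have fN x : f (- x) = - f x.
  by rewrite -mulN1r -fZ rmorphN rmorph1 scaleN1r.
pose F x : R[i]^o := f x +i* - f ('i%C *: x).
have lF : linear F.
  move=> k x y; rewrite /F.
  have -> : 'i%C *: (k *: x + y) = k *: ('i%C *: x) + 'i%C *: y.
    by rewrite scalerDr !scalerA mulrC.
  have kE z : f (k *: z) = complex.Re k * f z + complex.Im k * f ('i%C *: z).
    by rewrite [k in LHS]complexE scalerDl ['i%C * _]mulrC -scalerA fD !fZ.
  have ii : 'i%C *: ('i%C *: x) = - x by rewrite scalerA -expr2 sqr_i scaleN1r.
  rewrite /F !fD !kE ii fN; case: k {kE} => a b /=.
  by apply/eqP; rewrite eq_complex /=; apply/andP; split; apply/eqP; ring.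
have Fp x : rnorm (F x) <= p x.
  have p0 : 0 <= p x.
    have := fp x; have := fp (- x); rewrite fN.
    have := sp.2 (-1) x; rewrite scaleN1r /rnorm normrN1 mul1r; lra.
  have [->|Fx0] := eqVneq (F x) 0; first by rewrite /rnorm normr0.
  have n0 : 0 < rnorm (F x) by rewrite -ltcR -rnormE normr_gt0.
  set n := rnorm (F x) in n0 *.
  have nk : rnorm ((F x)^*%C * n^-1%:C : R[i]^o) = 1.
    apply: complexI; rewrite -rnormE normrM normcJ [`|F x|]rnormE.
    by rewrite ger0_norm ?ler0c ?invr_ge0 ?ltW// -rmorphM/= mulfV ?gt_eqF.
  have := fp ((F x)^*%C * n^-1%:C *: x); move/le_trans.
  move=> /(_ _ (sp.2 _ _)); rewrite nk mul1r; apply: le_trans.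
  have F0 : F 0 = 0.
    have f0 : f 0 = 0 by rewrite -(scale0r 0) fZ mul0r.
    by rewrite /F scaler0 f0 oppr0.
  have := lF ((F x)^*%C * n^-1%:C) x 0; rewrite F0 !addr0 => FE.
  rewrite -[f _]/(complex.Re (F ((F x)^*%C * n^-1%:C *: x))) FE.
  rewrite [_ *: _]mulrAC [_^*%C * _]mulrC -sqr_normc [`|F x|]rnormE.
  by rewrite -rmorphXn -rmorphM/= expr2 mulfK ?gt_eqF.
exists F; split=> //.
have fx0 : f x0 = p x0.
  apply/eqP; rewrite eq_le fp/=; have := le_trans (fr (- x0)) rx0.
  by rewrite fN lerN2.
have : `|F x0| ^+ 2 <= (p x0)%:C ^+ 2.
  by rewrite lerXn2r ?nnegrE ?normr_ge0// ?rnormE ?lecR// (le_trans _ (Fp x0))// rnorm_ge0.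
rewrite -add_Re2_Im2 -rmorphXn/= lecR fx0 gerDl sqrrN.
rewrite le_eqVlt ltNge sqr_ge0 orbF sqrf_eq0 => /eqP fi0.
by rewrite /F fx0 fi0 oppr0.
Qed.

End HahnBanach.

Section NormedHahnBanach.
Variables (R : realType) (X : normedModType R[i]).

Lemma rnormD (x y : X) : rnorm (x + y) <= rnorm x + rnorm y.
Proof. by rewrite -lecR rmorphD/= -!rnormE ler_normD. Qed.

Lemma rnorm0 : rnorm (0 : X) = 0. Proof. by rewrite /rnorm normr0. Qed.

Lemma rnorm_eq0 (x : X) : rnorm x = 0 -> x = 0.
Proof. by move=> x0; apply/eqP; rewrite -normr_eq0 rnormE x0. Qed.

Lemma le_normE (Y Z : normedModType R[i]) (y : Y) (z : Z) :
  (`|y| <= `|z|) = (rnorm y <= rnorm z).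
Proof. by rewrite !rnormE lecR. Qed.

Lemma seminorm_dual (p : X -> R) x0 : seminorm p -> (forall x, p x <= rnorm x) ->
  exists mu : dual X, [/\ rnorm mu <= 1, forall x, rnorm (mu x) <= p x &
    mu x0 = (p x0)%:C].
Proof.
move=> sp pn; have [F [lF Fp Fx0]] := seminorm_functional x0 sp.
have Fn x : `|F x| <= 1 * `|x|.
  by rewrite mul1r le_normE (le_trans (Fp x)).
exists (mkdual ler01 lF Fn); split=> //.
apply: dual_norm_le => x x1; apply: le_trans x1; apply: le_trans (pn x).
exact: Fp.
Qed.

Lemma norming_dual (x0 : X) :
  exists2 mu : dual X, rnorm mu <= 1 & mu x0 = (rnorm x0)%:C.
Proof.
have sn : seminorm (@rnorm R X).
  by split=> [x y|k x]; [exact: rnormD|rewrite rnormZ].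
by have [mu [? ? ?]] := seminorm_dual x0 sn (fun=> lexx _); exists mu.
Qed.

Lemma rnorm_le_dual (x : X) (M : R) :
  (forall mu : dual X, rnorm mu <= 1 -> rnorm (mu x) <= M) -> rnorm x <= M.
Proof.
move=> xM; have [mu mu1 mux] := norming_dual x.
by have := xM mu mu1; rewrite mux rnorm_real ?rnorm_ge0.
Qed.

Lemma dual_separates (x y : X) : (forall mu : dual X, mu x = mu y) -> x = y.
Proof.
move=> xy; apply/eqP; rewrite -subr_eq0; apply/eqP; apply: rnorm_eq0.
apply/eqP; rewrite eq_le rnorm_ge0 andbT; apply: rnorm_le_dual => mu _.
by rewrite (linearP_B (dual_linear mu)) xy subrr /rnorm normr0.
Qed.

End NormedHahnBanach.

(** The distance to the range of [Q] is a seminorm below the norm. A functional dominated by it and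
    attaining it at [x0] vanishes on the range, hence is [0]; so the distance is [0], and
    completeness of [S] turns approximation into equality. *)
Lemma isometry_surj (R : realType) (S : completeNormedModType R[i])
    (X : normedModType R[i]) (Q : S -> X) :
  linear Q -> (forall s, rnorm (Q s) = rnorm s) ->
  (forall mu : dual X, (forall s, mu (Q s) = 0) -> mu = 0) ->
  forall x, exists s, Q s = x.
Proof.
move=> lQ nQ Qdense x0.
pose E x := [set rnorm (x - Q s) | s in setT].
pose p x := inf (E x).
have hE x : has_inf (E x).
  split; first by exists (rnorm (x - Q 0)), 0.
  by exists 0 => _ [s _ <-]; exact: rnorm_ge0.
have QE s x : p x <= rnorm (x - Q s).
  by apply: ge_inf; [exact: (hE x).2|exists s].
have Q0 := linearP_0 lQ.
have p_seminorm : seminorm p.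
  split=> [x y|k x].
    rewrite -lerBlDr; apply: lb_le_inf; first exact: (hE x).1.
    move=> _ [s _ <-]; rewrite lerBlDr -lerBlDl; apply: lb_le_inf.
      exact: (hE y).1.
    move=> _ [t _ <-]; rewrite lerBlDl; apply: le_trans (QE (s + t) _) _.
    by rewrite (linearP_D lQ) opprD addrACA rnormD.
  have [->|k0] := eqVneq k 0.
    rewrite scale0r (rnorm0 _) mul0r; apply: le_trans (QE 0 _) _.
    by rewrite Q0 subrr rnorm0.
  have nk : 0 < rnorm (k : R[i]^o) by rewrite -ltcR -rnormE normr_gt0.
  rewrite -ler_pdivrMl//; apply: lb_le_inf; first exact: (hE x).1.
  move=> _ [s _ <-]; rewrite ler_pdivrMl//; apply: le_trans (QE (k *: s) _) _.
  by rewrite (linearP_Z lQ) -scalerBr rnormZ.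
have pn x : p x <= rnorm x.
  by apply: le_trans (QE 0 x) _; rewrite Q0 subr0.
have [mu [_ mup mux0]] := seminorm_dual x0 p_seminorm pn.
have mu0 : mu = 0.
  apply: Qdense => s; apply: rnorm_eq0; apply: le_anti; rewrite rnorm_ge0 andbT.
  apply: (le_trans (mup _)).
  by have := QE s (Q s); rewrite subrr rnorm0.
have px0 : p x0 = 0.
  by apply: complexI; rewrite -mux0 mu0.
(* Approximate preimages of [x0] form a Cauchy filter because [Q] preserves distances; its limit is
   a preimage. *)
pose B (e : R) : set S := [set s | rnorm (x0 - Q s) < e].
pose F := filter_from [set e : R | 0 < e] B.
have FF : ProperFilter F.
  apply: filter_from_proper.
    apply: filter_from_filter; first by exists 1 => /=.
    move=> e d /= e0 d0; exists (Num.min e d); first by rewrite /= lt_min e0.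
    by move=> s /=; rewrite /B/= lt_min => /andP[].
  move=> e /= e0; have [_ [s _ <-]] := inf_adherent e0 (hE x0).
  by rewrite -/(p x0) px0 add0r => xs; exists s.
have cF : cauchy F.
  apply: cauchy_exP => e' e'0; have [e ee] : exists e, e' = e%:C.
    by exists (complex.Re e'); rewrite RRe_real ?gtr0_real.
  move: e'0; rewrite ee ltcR => e'0; have e0 : 0 < e / 2 by rewrite divr_gt0.
  have [_ [s _ <-]] := inf_adherent e0 (hE x0).
  rewrite -/(p x0) px0 add0r => xs; exists s; exists (e / 2) => //.
  move=> t /=; rewrite /B/= => xt; rewrite -ball_normE/= rnormE.
  rewrite ltcR -nQ (linearP_B lQ).
  rewrite -(subrK x0 (Q s)) -addrA; apply: le_lt_trans (rnormD _ _) _.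
  by rewrite [ltRHS]splitr ltrD// /rnorm distrC.
have /cvg_ex[s Fs] : cvg F by exact: cauchy_cvg.
exists s; apply/eqP; rewrite eq_sym -subr_eq0; apply/eqP; apply: rnorm_eq0.
apply: le_anti; rewrite rnorm_ge0 andbT; apply/ler_addgt0Pl => e e0; rewrite addr0.
have e2 : 0 < e / 2 by rewrite divr_gt0.
have : F (ball s (e / 2)%:C) by apply: Fs; apply: nbhsx_ballx; rewrite ltcR.
move=> [d /= d0 dB].
have : F (B (Num.min d (e / 2))) by exists (Num.min d (e / 2)) => //=; rewrite lt_min d0.
move=> /filter_ex[t]; rewrite /B/= lt_min => /andP[td te].
have := dB t td; rewrite -ball_normE/= rnormE ltcR => ts.
rewrite -(subrK (Q t) x0) -addrA; apply: le_trans (rnormD _ _) _.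
rewrite [leRHS]splitr lerD ?(ltW te)// -(linearP_B lQ) nQ /rnorm distrC.
exact: ltW.
Qed.

Lemma rnorm_dual_le (R : realType) (X : normedModType R[i]) (f : dual X) x :
  rnorm (f x) <= rnorm f * rnorm x.
Proof. exact: dual_bound. Qed.

Lemma contractive2P (R : realType) (X Y Z : normedModType R[i]) (m : X -> Y -> Z) :
  contractive2 m <-> forall x y, rnorm (m x y) <= rnorm x * rnorm y.
Proof.
by split=> mc x y; [have := mc x y|]; rewrite !rnormE -rmorphM/= lecR.
Qed.

(** * Weak* continuous functionals *)

Section WeakStar.
Variables (R : realType) (X : normedModType R[i]).

Lemma weakstar_eval_continuous (x : X) : continuous (fun mu : weakstar X => mu x : R[i]^o).
Proof.
pose i (f : weakstar X) : {ptws X -> R[i]^o} := f.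
have ci : continuous i by exact: initial_continuous.
move=> mu; refine (@continuous_comp (weakstar X) {ptws X -> R[i]^o} R[i]^o i
  (fun f => f x) mu (ci mu) _).
exact: (@proj_continuous X (fun=> R[i]^o) x).
Qed.

Lemma open_eval_neq0 (x : X) : open [set nu : weakstar X | nu x != 0].
Proof.
have /continuousP/(_ (~` [set 0])) := @weakstar_eval_continuous x.
rewrite (_ : _ @^-1` _ = [set nu : weakstar X | nu x != 0]).
  apply; apply/closed_openC/accessible_closed_set1/hausdorff_accessible.
  exact: norm_hausdorff.
by apply/seteqP; split=> nu /= /eqP.
Qed.

Lemma weakstar_cvgP (F : set_system (dual X)) (mu : dual X) : Filter F ->
  F --> (mu : weakstar X) <->
  forall x, (fun nu : dual X => nu x : R[i]^o) @ F --> (mu x : R[i]^o).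
Proof.
move=> FF; split=> [Fmu x|Fmu].
  apply: (cvg_trans (cvg_app (fun nu : dual X => nu x : R[i]^o) Fmu)).
  exact: weakstar_eval_continuous.
have /pointwise_cvgP Fp : forall x, (fun g : X -> R[i]^o => g x) @
    ((fun f : dual X => f : X -> R[i]^o) @ F) --> (mu x : R[i]^o) by [].
move=> A [_ [[B oB <-] Bmu BA]]; apply: filterS BA _.
by apply: Fp; apply: open_nbhs_nbhs; split.
Qed.

(** A functional vanishing on the common kernel of finitely many evaluations is a combination of
    them, and such a combination is evaluation at a combination of points. In the induction, [w] in
    the kernel of [xs] with [w y = 1] isolates the contribution of [y], which is then subtracted. *)
Lemma functional_span (xs : seq X) (g : dual X -> R[i]^o) : linear g ->
  (forall nu : dual X, (forall x, x \in xs -> nu x = 0) -> g nu = 0) ->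
  exists x, forall nu, g nu = nu x.
Proof.
elim: xs g => [|y xs IH] g lg g0.
  by exists 0 => nu; rewrite g0// (linearP_0 (dual_linear nu)).
have [dep|] := pselect (forall nu : dual X,
    (forall x, x \in xs -> nu x = 0) -> nu y = 0).
  apply: IH => // nu nu0; apply: g0 => x; rewrite inE => /orP[/eqP ->|/nu0//].
  exact: dep.
move=> /existsNP[v /not_implyP[v0 vy0]]; have vy : v y != 0 by apply/eqP.
pose w := (v y)^-1 *: v.
have wy : w y = 1 by rewrite dualZE [LHS]mulVf.
have w0 x : x \in xs -> w x = 0 by move=> /v0 vx; rewrite dualZE vx scaler0.
have [||x xg] := IH (fun nu => g nu - g w *: nu y).
- move=> k m n; rewrite lg dualDE dualZE scalerBr scalerDr !scalerA [g w * k]mulrC.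
  by rewrite opprD addrACA.
- move=> nu nu0; have nuw x : x \in y :: xs -> (nu - nu y *: w) x = 0.
    rewrite -scaleNr dualDE dualZE inE => /orP[/eqP ->|xxs].
      by rewrite wy [_ *: _]mulr1 subrr.
    by rewrite nu0// w0// scaler0 addr0.
  have := g0 _ nuw; rewrite (linearP_B lg) (linearP_Z lg).
  by rewrite [g w *: _]mulrC.
exists (g w *: y + x) => nu.
by rewrite (dual_linear nu) -xg addrC subrK.
Qed.

(** Continuity at [0] means that finitely many evaluations control [g]; [G] is generated by the
    basic weak* neighbourhoods of [0]. *)
Lemma weakstar_functional (g : dual X -> R[i]^o) : linear g ->
  continuous (g : weakstar X -> R[i]^o) -> exists x, forall nu, g nu = nu x.
Proof.
move=> lg cg; pose D := [set p : seq X * R | 0 < p.2].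
pose B (p : seq X * R) : set (dual X) :=
  [set nu | forall x, x \in p.1 -> rnorm (nu x : R[i]^o) < p.2].
pose G := filter_from D B.
have FG : Filter G.
  apply: filter_from_filter; first by exists ([::], 1); rewrite /D/=.
  move=> [xs e] [ys d] /= e0 d0; exists (xs ++ ys, Num.min e d).
    by rewrite /D/= lt_min e0.
  move=> nu nuB; split=> x /= xx.
    by have /= := nuB x; rewrite mem_cat xx lt_min => /(_ isT)/andP[].
  by have /= := nuB x; rewrite mem_cat xx orbT lt_min => /(_ isT)/andP[].
have G0 : G --> (0 : weakstar X).
  apply/weakstar_cvgP => x; apply/cvgrPdist_lt => e e0.
  have [d ed] : exists d, e = d%:C.
    by exists (complex.Re e); rewrite RRe_real ?gtr0_real.
  move: e0; rewrite ed ltcR => d0; exists ([:: x], d) => // nu /= /(_ x).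
  by rewrite inE eqxx sub0r normrN rnormE ltcR; exact.
have [[xs e] /= e0 Bg] : G [set nu | `|g nu| < 1].
  apply: G0; have /cvgrPdist_lt/(_ _ ltr01) := cg 0.
  by apply: filterS => nu /=; rewrite (linearP_0 lg) sub0r normrN.
(* If [g nu] were nonzero, [nu / g nu] would still vanish on [xs], hence lie where [|g| < 1],
   although [g] takes the value [1] at it. *)
apply: (@functional_span xs) => // nu nu0; apply/eqP; apply: contraT => gnu0.
have /Bg : B (xs, e) ((g nu)^-1 *: nu).
  move=> x xxs; rewrite -[X in rnorm X]/((g nu)^-1 *: nu x).
  by rewrite nu0// scaler0 rnorm0.
by rewrite /= (linearP_Z lg) [_ *: _]mulVf// normr1 ltxx.
Qed.

End WeakStar.

Lemma weakstar_continuousP (R : realType) (X Y : normedModType R[i]) (T : dual X -> dual Y) :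
  weakstar_continuous T <->
  forall y, continuous (fun mu : weakstar X => T mu y : R[i]^o).
Proof.
split=> [cT y mu|cT mu].
  refine (@continuous_comp (weakstar X) (weakstar Y) R[i]^o T
    (fun nu => nu y) mu (cT mu) _).
  exact: weakstar_eval_continuous.
have FT : Filter ((T : weakstar X -> weakstar Y) @ mu).
  exact: (@fmap_filter _ _ T (nbhs (mu : weakstar X))).
by apply: (proj2 (weakstar_cvgP (T mu) FT)) => y; exact: cT.
Qed.

(** * Banach algebras *)

(** [Q] is the inverse of [T] on its range, and the norm of [P] is carried over along it, so
    completeness is inherited from [P]. *)
Lemma transport_banachSubspace (R : realType) (V : lmodType R[i])
    (P : completeNormedModType R[i]) (T : P -> V) :
  linear T -> injective T ->
  exists (S : banachSubspace V) (Q : S -> P),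
    [/\ linear Q, forall p, exists s, Q s = p, forall s, `|Q s| = `|s| &
        forall s, T (Q s) = bs_val s].
Proof.
move=> lT Tinj.
pose U : {pred V} := fun v => `[< exists p, T p = v >].
have Usub : submod_closed U.
  split; first by apply/asboolP; exists 0; exact: linearP_0.
  move=> k _ _ /asboolP[p <-] /asboolP[q <-]; apply/asboolP.
  by exists (k *: p + q); rewrite lT.
pose W := Subspace Usub.
have TQ (x : subspace_type W) : {p | T p = Defs.sval x}.
  by apply: cid; have := Defs.svalP x => /asboolP.
pose Q x := projT1 (TQ x).
have QE x : T (Q x) = Defs.sval x := projT2 (TQ x).
have lQ : linear Q.
  by move=> k x y; apply: Tinj; rewrite lT !QE.
have QD x y : `|Q (x + y)| <= `|Q x| + `|Q y|.
  by rewrite (linearP_D lQ) ler_normD.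
have QZ (k : R[i]) x : `|Q (k *: x)| = `|k| * `|Q x|.
  by rewrite (linearP_Z lQ) normrZ.
have Q0 x : `|Q x| = 0 -> x = 0.
  move=> /eqP; rewrite normr_eq0 => /eqP Qx0; apply/val_inj => /=.
  by rewrite -QE Qx0 (linearP_0 lT).
pose N := NormedSubspace QD QZ Q0.
have Qsurj p : exists s : ns_type N, Q s = p.
  have Tp : T p \in W by apply/asboolP; exists p.
  by exists (SubspaceElt Tp); apply: Tinj; rewrite QE.
have Qball (x y : ns_type N) e : ball x e y <-> ball (Q x) e (Q y).
  by rewrite -!ball_normE/= -(linearP_B lQ).
have Ncomplete (F : set_system (ns_type N)) : ProperFilter F -> cauchy F -> cvg F.
  move=> FF /cauchyP Fc.
  have FQ : ProperFilter (Q @ F) by exact: fmap_proper_filter.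
  have /cauchy_cvg/cvg_ex[p Fp] : cauchy (Q @ F).
    apply/cauchyP => e e0; have [x Fx] := Fc e e0.
    exists (Q x); rewrite /fmap/=; apply: filterS Fx => y xy.
    exact: (proj1 (Qball x y e)).
  have [s sp] := Qsurj p; apply/cvg_ex; exists s.
  apply/cvg_ballP => e e0; have /cvg_ballP/(_ e e0) := Fp.
  rewrite -sp /nbhs/= /fmap/=; apply: filterS => y; exact: (proj2 (Qball s y e)).
exists (BanachSubspace Ncomplete), Q; split=> //.
Qed.

Section IsometryDual.
Variables (R : realType) (X Y : normedModType R[i]) (Q : X -> Y).
Hypotheses (lQ : linear Q) (Qsurj : forall y, exists x, Q x = y)
  (nQ : forall x, rnorm (Q x) = rnorm x).

Lemma pullback_linear (nu : dual Y) : linear (fun x => nu (Q x)).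
Proof. by move=> k x y; rewrite lQ dual_linear. Qed.

Lemma pullback_bound (nu : dual Y) x : `|nu (Q x)| <= `|nu| * `|x|.
Proof. by apply: le_trans (ler_dual _ _) _; rewrite !rnormE nQ. Qed.

Definition pullback (nu : dual Y) : dual X :=
  mkdual (normr_ge0 nu) (pullback_linear nu) (pullback_bound nu).

(** Being isometric, [Q] is injective, and [mu] composed with its inverse is a bounded
    functional. *)
Lemma pullback_surj (mu : dual X) : exists nu, pullback nu = mu.
Proof.
have Qinv y : {x | Q x = y} by apply: cid.
pose g y := mu (projT1 (Qinv y)).
have Qinj x x' : Q x = Q x' -> x = x'.
  move=> xx'; apply/eqP; rewrite -subr_eq0; apply/eqP; apply: rnorm_eq0.
  by rewrite -nQ (linearP_B lQ) xx' subrr rnorm0.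
have gQ x : g (Q x) = mu x.
  by congr (mu _); apply: Qinj; exact: (projT2 (Qinv (Q x))).
have lg : linear g.
  move=> k y y'; have [[x <-] [x' <-]] := (Qsurj y, Qsurj y').
  by rewrite -lQ !gQ dual_linear.
have gn y : `|g y| <= `|mu| * `|y|.
  have [x <-] := Qsurj y; rewrite gQ; apply: le_trans (ler_dual _ _) _.
  by rewrite !rnormE nQ.
exists (mkdual (normr_ge0 mu) lg gn); apply: dual_ext => x; exact: gQ.
Qed.

Lemma pullback_norm (nu : dual Y) : `|pullback nu| = `|nu|.
Proof.
rewrite !dual_normE /dual_norm; congr (sup _)%:C.
apply/seteqP; split=> _ [x /= x1 <-]; first by exists (Q x) => //=; rewrite nQ.
by have [x' xE] := Qsurj x; exists x'; rewrite /= -?nQ xE.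
Qed.

End IsometryDual.

Section Represents.
Variables (R : realType) (A : banachAlg R) (B : dualAlgOver A).
Hypothesis hB : HLDBA B.
Local Notation P := (predual B).

(* Elements of S, as functionals on A, are read off the predual through eta. *)
Definition represents (S : banachSubspace (dual A)) (Q : S -> P) :=
  [/\ linear Q, forall p, exists s, Q s = p, forall s, rnorm (Q s) = rnorm s &
      forall s a, (bs_val s : dual A) a = deta B a (Q s)].

Lemma eta_bound_predual (p : P) (a : A) : `|deta B a p| <= `|p| * `|a|.
Proof.
apply: (le_trans (ler_dual _ _)); rewrite mulrC ler_wpM2l//.
exact: (hl_eta_contr hB).
Qed.

Lemma eta_linear_predual (p : P) : linear (fun a => deta B a p).
Proof. by move=> k a b; rewrite (hl_eta_linear hB). Qed.

Definition pretranspose (p : P) : dual A :=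
  mkdual (normr_ge0 p) (eta_linear_predual p) (eta_bound_predual p).

(** If some [mu] distinguishes [p] from [q], the functionals nonzero at [p - q] form a nonempty
    weak* open set, which the dense range of [deta B] must meet. *)
Lemma eta_separates (p q : P) : (forall a, deta B a p = deta B a q) -> p = q.
Proof.
move=> pq; apply: dual_separates => mu; apply/eqP; apply: contraT => mupq.
pose D (x : P) : set (weakstar P) := [set nu | nu x != 0].
have oD x : open (D x). exact: open_eval_neq0.
have [|nu [Dnu [a _ anu]]] := hl_eta_dense hB _ (oD (p - q)).
  by exists mu; rewrite /D/= (linearP_B (dual_linear mu)) subr_eq0.
by move: Dnu; rewrite /D/= -anu (linearP_B (dual_linear _)) pq subrr eqxx.
Qed.

(** The point [p'] is [p] acted on by [a]: at [mu = deta B b] the equation reads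
    [deta B (a b) p = deta B b p']. The topological centre supplies the weak* continuity. *)
Lemma eta_act_predual (a : A) (p : P) :
  exists p', forall mu, dmul (deta B a) mu p = mu p'.
Proof.
apply: weakstar_functional.
  by move=> k m n; rewrite (bp_linearr (hl_mul hB)).
exact: (proj1 (weakstar_continuousP _) (hl_eta_center hB (imageT _ a))).
Qed.

(** Here [p'] plays the role of [mu] square [p]; the continuity is that of [nu |-> nu mu]. *)
Lemma box_predual (mu : dual P) (p : P) :
  exists p', forall nu, dmul nu mu p = nu p'.
Proof.
apply: weakstar_functional.
  by move=> k m n; rewrite (bp_linearl (hl_mul hB)).
exact: (proj1 (weakstar_continuousP _) (@hl_mul_cont R A B hB mu) p).
Qed.

Section Given.
Variables (S : banachSubspace (dual A)) (Q : S -> P).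
Hypothesis SQ : represents Q.

Lemma represents_mem (phi : dual A) (p : P) :
  (forall a, phi a = deta B a p) -> phi \in S.
Proof.
case: SQ => _ Qs _ SQe phip; have [s sp] := Qs p.
rewrite (_ : phi = bs_val s) ?bs_valP//.
by apply: dual_ext => a; rewrite SQe sp.
Qed.

Lemma represents_act_closed : act_closed S.
Proof.
move=> s a; have [p pE] := eta_act_predual a (Q s); case: SQ => _ _ _ SQe.
apply: (represents_mem (p := p)) => b.
by rewrite -pE -(hl_eta_mul hB) -SQe.
Qed.

(** For [mu] in the range of [deta B] this is multiplicativity of [deta B]. It extends to all [mu]
    because both sides evaluate [mu] at a point of [P], and [deta B] separates points. *)
Lemma represents_act (Sact : act_closed S) (s : S) a (mu : dual P) :
  mu (Q (sub_act Sact s a)) = dmul (deta B a) mu (Q s).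
Proof.
have [p pE] := eta_act_predual a (Q s); rewrite pE; congr (mu _).
case: SQ => _ _ _ SQe; apply: eta_separates => b.
by rewrite -pE -(hl_eta_mul hB) -!SQe.
Qed.

Lemma represents_contr (s : S) : `|bs_val s| <= `|s|.
Proof.
case: SQ => _ _ nQ SQe; rewrite rnormE [`|s|]rnormE lecR -nQ.
apply: dual_norm_le => a a1; rewrite SQe.
have := eta_bound_predual (Q s) a; rewrite !rnormE -rmorphM/= lecR => /le_trans.
by apply; rewrite ler_piMr// rnorm_ge0.
Qed.

(** The norm of [S] is that of [P], so it is tested on the unit ball of the dual of [P], where the
    action becomes left multiplication by [deta B a]. *)
Lemma represents_act_contr (Sact : act_closed S) : contractive2 (sub_act Sact).
Proof.
case: SQ => _ _ nQ _; apply/contractive2P => s a; rewrite -nQ.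
apply: rnorm_le_dual => mu mu1; rewrite represents_act -nQ.
apply: le_trans (rnorm_dual_le _ _) _; rewrite mulrC ler_wpM2l ?rnorm_ge0//.
apply: le_trans (proj1 (contractive2P _) (bp_norm (hl_mul hB)) _ _) _.
rewrite -[leRHS]mulr1 ler_pM ?rnorm_ge0//.
by rewrite -le_normE (hl_eta_contr hB).
Qed.

Variables (Sact : act_closed S) (Sactn : contractive2 (sub_act Sact)).

Lemma represents_boxE (mu : dual S) (nu : dual P) (s : S) (p : P) :
  (forall t, mu t = nu (Q t)) -> (forall ka, dmul ka nu (Q s) = ka p) ->
  forall a, box Sactn mu s a = deta B a p.
Proof.
by move=> munu pE a; rewrite -pE -(represents_act Sact s a nu) -munu.
Qed.

Lemma represents_dual (mu : dual S) :
  exists2 nu : dual P, (forall t, mu t = nu (Q t)) & rnorm nu = rnorm mu.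
Proof.
case: SQ => lQ Qs nQ _; have [nu numu] := pullback_surj lQ Qs nQ mu.
by exists nu; rewrite -numu//; apply: complexI; rewrite -!rnormE pullback_norm.
Qed.

Lemma represents_box_closed : box_closed Sactn.
Proof.
move=> mu s; have [nu munu _] := represents_dual mu.
have [p pE] := box_predual nu (Q s).
exact: represents_mem (represents_boxE munu pE).
Qed.

Lemma represents_box (Sbox : box_closed Sactn) (mu : dual S) (nu : dual P)
    (s : S) (ka : dual P) : (forall t, mu t = nu (Q t)) ->
  ka (Q (sub_box Sbox mu s)) = dmul ka nu (Q s).
Proof.
move=> munu; have [p pE] := box_predual nu (Q s).
rewrite pE; congr (ka _); case: SQ => _ _ _ SQe; apply: eta_separates => a.
by rewrite -SQe -(represents_boxE munu pE).
Qed.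

Lemma represents_box_contr (Sbox : box_closed Sactn) : contractive2 (sub_box Sbox).
Proof.
apply/contractive2P => mu s; have [nu munu numu] := represents_dual mu.
case: SQ => _ _ nQ _; rewrite -[leLHS]nQ.
apply: rnorm_le_dual => ka ka1; rewrite (represents_box _ _ _ munu) -nQ -numu.
apply: le_trans (rnorm_dual_le _ _) _; rewrite ler_wpM2r ?rnorm_ge0//.
apply: le_trans (proj1 (contractive2P _) (bp_norm (hl_mul hB)) _ _) _.
by rewrite ler_piMl ?rnorm_ge0.
Qed.

End Given.

Lemma exists_introverted_represents :
  exists (S : introverted A) (Q : S -> P), represents Q.
Proof.
have lT : linear pretranspose.
  by move=> k p q; apply: dual_ext => a; exact: dual_linear.
have Tinj : injective pretranspose.
  move=> p q pq; apply: eta_separates => a.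
  by rewrite -[LHS]/(pretranspose p a) pq.
have [S [Q [lQ Qs nQ TQ]]] := transport_banachSubspace lT Tinj.
have SQ : represents Q.
  split=> //; first by move=> s; apply: complexI; rewrite -!rnormE.
  by move=> s a; rewrite -TQ.
have Sactn := represents_act_contr SQ (represents_act_closed SQ).
have Sbox : box_closed Sactn by exact: (represents_box_closed SQ).
by exists (Introverted (represents_contr SQ) (represents_box_contr SQ Sbox)), Q.
Qed.

(** The equivalence is the adjoint of [Q]; its weak* continuity is that of the evaluations at the
    points [Q s]. *)
Lemma represents_iso (S : introverted A) (Q : S -> P) : represents Q ->
  exists Phi : dual P -> dual S, @hldba_iso R A B (arensAlg S) Phi /\
    forall nu s, Phi nu s = nu (Q s).
Proof.
move=> SQ; case: (SQ) => lQ Qs nQ SQe; exists (pullback lQ nQ); split=> //.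
split=> //.
- by move=> k mu nu; apply: (@dual_ext _ S).
- move=> mu nu; apply: (@dual_ext _ S) => s.
  by rewrite /= (represents_box SQ _ s mu (nu := nu)).
- by move=> mu; rewrite pullback_norm.
- apply/seteqP; split=> // mu _; have [nu <-] := pullback_surj lQ Qs nQ mu.
  by exists nu.
- by apply/weakstar_continuousP => s; exact: (@weakstar_eval_continuous R P (Q s)).
by move=> a; apply: (@dual_ext _ S) => s /=; rewrite SQe.
Qed.

Lemma iso_represents (S : introverted A) (Phi : dual P -> dual S) :
  @hldba_iso R A B (arensAlg S) Phi ->
  exists2 Q : S -> P, represents Q & forall nu s, Phi nu s = nu (Q s).
Proof.
move=> [lPhi _ nPhi sPhi cPhi ePhi].
have PhiQ s : {p | forall nu, Phi nu s = nu p}.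
  apply: cid; apply: weakstar_functional; first by move=> k x y; rewrite lPhi.
  exact: (proj1 (weakstar_continuousP _) cPhi).
pose Q s := projT1 (PhiQ s).
have QE s nu : Phi nu s = nu (Q s) := projT2 (PhiQ s) nu.
have nPhi' nu : rnorm (Phi nu) = rnorm nu.
  by apply: complexI; rewrite -!rnormE nPhi.
have lQ : linear Q.
  move=> k x y; apply: dual_separates => nu.
  by rewrite dual_linear -!QE dual_linear.
(* Each inequality tests on the unit ball of one dual; for the second, surjectivity lets every
   functional on [S] be written as [Phi nu]. *)
have nQ s : rnorm (Q s) = rnorm s.
  apply: le_anti; apply/andP; split.
    apply: rnorm_le_dual => nu nu1; rewrite -QE.
    apply: le_trans (rnorm_dual_le _ _) _; rewrite ler_piMl ?rnorm_ge0//.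
    by rewrite nPhi'.
  apply: rnorm_le_dual => mu mu1.
  have [nu _ numu] : range Phi mu by rewrite sPhi.
  move: mu1; rewrite -numu nPhi' QE => nu1.
  by apply: le_trans (rnorm_dual_le _ _) _; rewrite ler_piMl ?rnorm_ge0.
exists Q => //; split=> //.
  (* A functional vanishing on the range of [Q] is sent to [0] by [Phi], which preserves norms. *)
  apply: (isometry_surj lQ nQ) => nu nuQ; apply: rnorm_eq0; rewrite -nPhi'.
  by rewrite (_ : Phi nu = 0) ?rnorm0//; apply: dual_ext => s; rewrite QE nuQ.
by move=> s a; rewrite -QE ePhi.
Qed.

(** In both cases membership means being of the form [a |-> deta B a p], a condition on [B]
    alone. *)
Lemma represents_mem_eq (S S' : introverted A) (Q : S -> P) (Q' : S' -> P) :
  represents Q -> represents Q' ->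
  (forall phi, (phi \in in_space S) = (phi \in in_space S')).
Proof.
move=> SQ SQ' phi; apply/idP/idP => phiS.
  apply: (represents_mem SQ' (p := Q (bs_in phiS))) => a.
  by case: SQ => _ _ _ <-.
apply: (represents_mem SQ (p := Q' (bs_in phiS))) => a.
by case: SQ' => _ _ _ <-.
Qed.

Lemma represents_eq (S S' : introverted A) (Q : S -> P) (Q' : S' -> P)
    (s : S) (s' : S') :
  represents Q -> represents Q' -> bs_val s = bs_val s' -> Q s = Q' s'.
Proof.
move=> [_ _ _ SQe] [_ _ _ SQe'] ss'; apply: eta_separates => a.
by rewrite -SQe -SQe' ss'.
Qed.

End Represents.

Lemma hldba_unique_arens (R : realType) (A : banachAlg R) (B : dualAlgOver A) :
  HLDBA B -> exists! S : introverted A, hldba_equiv B (arensAlg S).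
Proof.
move=> hB; have [S [Q SQ]] := exists_introverted_represents hB.
exists S; split.
  by have [Phi [iPhi _]] := represents_iso hB SQ; exists Phi.
move=> S' [Phi /iso_represents[Q' SQ' _]].
apply: introverted_ext; first exact: (represents_mem_eq SQ SQ').
move=> s s' ss'; rewrite !rnormE; case: (SQ) => _ _ <- _; case: (SQ') => _ _ <- _.
by rewrite (represents_eq hB SQ SQ' ss').
Qed.

(** * Operator norms of complex matrices *)

Lemma sum_pair (V : nmodType) (I J : finType) (F : I * J -> V) :
  \sum_p F p = \sum_i \sum_j F (i, j).
Proof. by rewrite pair_bigA; apply: eq_bigr => -[]. Qed.

Section VectorNorm.
Variable R : realType.
Local Notation C := R[i].
Local Notation cabs z := (rnorm (z : R[i]^o)).
Implicit Types I J : finType.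

(** Arbitrary finite index types let pairs index tensor products without being numbered. *)
Definition vnorm I (u : I -> C) : R :=
  Num.sqrt (\sum_i (cabs (u i)) ^+ 2).

Lemma vnorm_ge0 I (u : I -> C) : 0 <= vnorm u. Proof. exact: sqrtr_ge0. Qed.

Lemma sqr_vnorm I (u : I -> C) : vnorm u ^+ 2 = \sum_i (cabs (u i)) ^+ 2.
Proof. by rewrite sqr_sqrtr// sumr_ge0// => i _; exact: sqr_ge0. Qed.

Lemma rnormM (a b : C) : cabs (a * b) = cabs (a) * cabs (b).
Proof. exact: (rnormZ a (b : C^o)). Qed.

Lemma vnormZ I (k : C) (u : I -> C) :
  vnorm (fun i => k * u i) = cabs (k) * vnorm u.
Proof.
apply/eqP; rewrite -(@eqrXn2 _ 2) ?mulr_ge0 ?vnorm_ge0 ?rnorm_ge0//.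
rewrite exprMn !sqr_vnorm mulr_sumr; apply/eqP/eq_bigr => i _.
by rewrite rnormM exprMn.
Qed.

Lemma rnorm_sum (V : normedModType C) I (r : seq I) (P : pred I) (F : I -> V) :
  rnorm (\sum_(i <- r | P i) F i) <= \sum_(i <- r | P i) rnorm (F i).
Proof.
elim/big_rec2: _ => [|i x y _ xy]; first by rewrite rnorm0.
by apply: le_trans (rnormD _ _) _; rewrite lerD2l.
Qed.

Lemma vnorm_eq0 I (u : I -> C) i : vnorm u = 0 -> u i = 0.
Proof.
move=> u0; have := sqr_vnorm u; rewrite u0 expr0n/= => /esym.
move/psumr_eq0P => /(_ (fun _ _ => sqr_ge0 _) i isT)/eqP.
by rewrite sqrf_eq0 => /eqP/(@rnorm_eq0 _ C^o).
Qed.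

Lemma cauchy_schwarz I (u v : I -> C) :
  \sum_i cabs (u i) * cabs (v i) <= vnorm u * vnorm v.
Proof.
have [u0|u0] := eqVneq (vnorm u) 0.
  by rewrite u0 mul0r big1// => i _; rewrite (vnorm_eq0 i u0) rnorm0 mul0r.
have [v0|v0] := eqVneq (vnorm v) 0.
  by rewrite v0 mulr0 big1// => i _; rewrite (vnorm_eq0 i v0) rnorm0 mulr0.
set a := vnorm u in u0 *; set b := vnorm v in v0 *.
have a0 : 0 < a by rewrite lt_neqAle eq_sym u0 vnorm_ge0.
have b0 : 0 < b by rewrite lt_neqAle eq_sym v0 vnorm_ge0.
(* The weighted inequality [2 x y <= (b/a) x^2 + (a/b) y^2] is summed; the weights are chosen so
   that the right side adds up to [2 a b]. *)
have E : \sum_i (b / a * cabs (u i) ^+ 2 + a / b * cabs (v i) ^+ 2) = 2 * (a * b).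
  rewrite big_split/= -!mulr_sumr -!sqr_vnorm -/a -/b; field.
  by rewrite u0 v0.
rewrite -(@ler_pM2l _ 2)// -E mulr_sumr; apply: ler_sum => i _.
set x := cabs (u i); set y := cabs (v i).
have : 0 <= (b * x - a * y) ^+ 2 / (a * b) by rewrite divr_ge0 ?sqr_ge0// mulr_ge0 ?ltW.
suff -> : (b * x - a * y) ^+ 2 / (a * b) =
   (b / a * x ^+ 2 + a / b * y ^+ 2) - 2 * (x * y) by rewrite subr_ge0.
by field; rewrite u0 v0.
Qed.

Lemma dot_le I (u v : I -> C) : cabs (\sum_i u i * v i) <= vnorm u * vnorm v.
Proof.
apply: le_trans (rnorm_sum _ _ _) (le_trans _ (cauchy_schwarz u v)).
by apply: ler_sum => i _; rewrite rnormM.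
Qed.

Lemma vnorm_reindex I J (h : J -> I) (u : I -> C) : bijective h ->
  vnorm (u \o h) = vnorm u.
Proof. by move=> hb; rewrite /vnorm [in RHS](reindex h)//; apply: onW_bij. Qed.

Definition bilin I J (a : I -> J -> C) (u : I -> C) (v : J -> C) : C :=
  \sum_i \sum_j u i * a i j * v j.

(** For [M >= 0]: operator norm at most [M], without a supremum. Bilinear forms do as well as
    sesquilinear ones, since conjugation preserves [vnorm]. *)
Definition opbound I J (a : I -> J -> C) (M : R) :=
  forall u v, cabs (bilin a u v) <= M * vnorm u * vnorm v.

Lemma opbound_reindex I J (h : J -> I) (a : I -> I -> C) M : bijective h ->
  opbound a M -> opbound (fun i j => a (h i) (h j)) M.
Proof.
move=> hb aM u v; have [g hK gK] := hb; have gb : bijective g by exists h.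
rewrite -(vnorm_reindex u gb) -(vnorm_reindex v gb).
apply: le_trans (aM _ _); rewrite le_eqVlt; apply/orP; left; apply/eqP.
congr (rnorm _); rewrite /bilin [in RHS](reindex h)/=; last exact: onW_bij.
apply: eq_bigr => i _; rewrite [in RHS](reindex h)/=; last exact: onW_bij.
by apply: eq_bigr => j _; rewrite !hK.
Qed.

Lemma vnorm_prod I J (u : I * J -> C) :
  vnorm u = vnorm (fun i => (vnorm (fun j => u (i, j)))%:C).
Proof.
rewrite {1 2}/vnorm; congr Num.sqrt; rewrite sum_pair.
by apply: eq_bigr => i _; rewrite rnorm_real ?vnorm_ge0// sqr_vnorm.
Qed.

Lemma vnorm_tensor I J (u : I -> C) (v : J -> C) :
  vnorm (fun p : I * J => u p.1 * v p.2) = vnorm u * vnorm v.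
Proof.
rewrite vnorm_prod /= (_ : (fun i => _) = fun i => (cabs (u i) * vnorm v)%:C).
  rewrite /vnorm -sqrtrM ?sumr_ge0 ?vnorm_ge0//; last by move=> i _; exact: sqr_ge0.
  congr Num.sqrt; rewrite mulr_suml; apply: eq_bigr => i _.
  by rewrite rnorm_real ?mulr_ge0 ?vnorm_ge0 ?rnorm_ge0// exprMn sqr_vnorm.
by apply/funext => i; rewrite vnormZ.
Qed.

(** The Hilbert-Schmidt norm: crude in general, which is enough to make suprema finite, but exact
    for a single row or column. *)
Definition hsnorm I J (a : I -> J -> C) : R := vnorm (fun p : I * J => a p.1 p.2).

Lemma opbound_hs I J (a : I -> J -> C) : opbound a (hsnorm a).
Proof.
move=> u v; rewrite -mulrA -vnorm_tensor.
apply: le_trans (dot_le _ _); rewrite le_eqVlt; apply/orP; left; apply/eqP.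
congr (rnorm _); rewrite /bilin pair_bigA; apply: eq_bigr => -[i j] _ /=.
by rewrite mulrA [u i * _]mulrC.
Qed.

Lemma hnormE n (v : 'cV[C]_n) : hnorm v = vnorm (fun i => v i 0).
Proof. by []. Qed.

Lemma cabsE (z : C) : (cabs z)%:C = `|z|. Proof. by rewrite -rnormE. Qed.

Lemma cabsJ (z : C) : cabs (z^*%C) = cabs z.
Proof. by apply: complexI; rewrite !cabsE normcJ. Qed.

Lemma sqr_cabs (z : C) : (cabs z ^+ 2)%:C = z^*%C * z.
Proof. by rewrite rmorphXn/= cabsE sqr_normc mulrC. Qed.

Lemma vnormJ I (u : I -> C) : vnorm (fun i => (u i)^*%C) = vnorm u.
Proof. by congr Num.sqrt; apply: eq_bigr => i _; rewrite cabsJ. Qed.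

Lemma hnorm_mulmx_le m n (a : 'M[C]_(m, n)) M (v : 'cV[C]_n) :
  0 <= M -> opbound (fun i j => a i j) M -> hnorm (a *m v) <= M * hnorm v.
Proof.
(* Tested against the conjugate of [a v], the form equals the squared norm of [a v], and one factor
   cancels. *)
set w := a *m v => M0 aM; have := aM (fun i => (w i 0)^*%C) (fun j => v j 0).
rewrite vnormJ -!hnormE.
have -> : bilin (fun i j => a i j) (fun i => (w i 0)^*%C) (fun j => v j 0)
    = (hnorm w ^+ 2)%:C.
  rewrite hnormE sqr_vnorm rmorph_sum; apply: eq_bigr => i _ /=.
  rewrite sqr_cabs (_ : _ * w i 0 = (w i 0)^*%C * \sum_j a i j * v j 0).
    by rewrite mulr_sumr; apply: eq_bigr => j _; rewrite mulrA.
  by congr (_ * _); rewrite mxE.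
rewrite rnorm_real ?sqr_ge0//; have [w0|w0] := eqVneq (hnorm w) 0.
  by move=> _; rewrite w0 mulr_ge0// vnorm_ge0.
by rewrite expr2 mulrAC ler_pM2r// lt_neqAle eq_sym w0 vnorm_ge0.
Qed.

Lemma hnorm0 n : hnorm (0 : 'cV[C]_n) = 0.
Proof. by rewrite /hnorm big1 ?sqrtr0// => i _; rewrite mxE rnorm0 expr0n. Qed.

Lemma mx_opnorm_le m n (a : 'M[C]_(m, n)) (M : R) : 0 <= M ->
  opbound (fun i j => a i j) M -> mx_opnorm a <= M.
Proof.
move=> M0 aM; apply: ge_sup.
  by exists (hnorm (a *m 0)), 0 => //=; rewrite hnorm0 ler01.
move=> _ [v /= v1 <-]; apply: le_trans (hnorm_mulmx_le v M0 aM) _.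
by rewrite ler_piMr.
Qed.

Lemma mx_opnorm_ub m n (a : 'M[C]_(m, n)) (v : 'cV[C]_n) :
  hnorm v <= 1 -> hnorm (a *m v) <= mx_opnorm a.
Proof.
have hs0 : 0 <= hsnorm (fun i j => a i j) := vnorm_ge0 _.
move=> v1; apply: ub_le_sup; last by exists v.
exists (hsnorm (fun i j => a i j)) => _ [z /= z1 <-].
apply: le_trans (hnorm_mulmx_le z hs0 (@opbound_hs _ _ _)) _.
by rewrite ler_piMr.
Qed.

Lemma mx_opnorm_ge0 m n (a : 'M[C]_(m, n)) : 0 <= mx_opnorm a.
Proof.
by have := @mx_opnorm_ub _ _ a 0; rewrite mulmx0 !hnorm0 ler01; exact.
Qed.

Lemma mx_opnorm_ge m n (a : 'M[C]_(m, n)) (v : 'cV[C]_n) :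
  hnorm (a *m v) <= mx_opnorm a * hnorm v.
Proof.
have hZ l (k : C) (w : 'cV[C]_l) : hnorm (k *: w) = cabs k * hnorm w.
  rewrite !hnormE -vnormZ; congr vnorm; apply/funext => i; by rewrite mxE.
have [v0|v0] := eqVneq (hnorm v) 0.
  have -> : v = 0 by apply/colP => i; rewrite mxE; exact: (vnorm_eq0 i v0).
  by rewrite mulmx0 !hnorm0 mulr0.
have vp : 0 < hnorm v by rewrite lt_neqAle eq_sym v0 vnorm_ge0.
have nV : cabs ((hnorm v)^-1%:C) = (hnorm v)^-1 by rewrite rnorm_real ?invr_ge0 ?ltW.
have := @mx_opnorm_ub _ _ a ((hnorm v)^-1%:C *: v).
rewrite -scalemxAr !hZ nV mulVf// lexx => /(_ isT).
by rewrite ler_pdivrMl// mulrC.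
Qed.

Lemma mx_opnorm_bound m n (a : 'M[C]_(m, n)) :
  opbound (fun i j => a i j) (mx_opnorm a).
Proof.
move=> u v; have := mx_opnorm_ge a (\col_j v j).
rewrite (_ : hnorm (\col_j v j) = vnorm v); last first.
  by rewrite hnormE; congr vnorm; apply/funext => j; rewrite mxE.
move=> av; rewrite mulrAC mulrC; apply: le_trans (ler_wpM2l (vnorm_ge0 _) av).
apply: le_trans (dot_le _ _); rewrite le_eqVlt; apply/orP; left; apply/eqP.
congr (rnorm _); apply: eq_bigr => i _; rewrite mxE mulr_sumr.
by apply: eq_bigr => j _; rewrite mxE mulrA.
Qed.

Lemma opbound_le I J (a : I -> J -> C) M M' : M <= M' -> opbound a M -> opbound a M'.
Proof.
move=> MM aM u v; apply: le_trans (aM u v) _.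
by rewrite -!mulrA ler_wpM2r// mulr_ge0 ?vnorm_ge0.
Qed.

End VectorNorm.

(** * Matrix norms on a dual space *)

Section OperatorSpace.
Variable R : realType.
Local Notation C := R[i].
Local Notation cabs z := (rnorm (z : R[i]^o)).

Lemma amplify_reindex (X Y : Type) (m : X -> Y -> C) r s
    (x : 'M[X]_r) (y : 'M[Y]_s) M :
  opbound (fun p q => amplify m x y p q) M <->
  opbound (fun p q : 'I_r * 'I_s => m (x p.1 q.1) (y p.2 q.2)) M.
Proof.
have hb : bijective (@mxtens_unindex r s).
  by exists (@mxtens_index r s); [exact: mxtens_unindexK|exact: mxtens_indexK].
have ib : bijective (@mxtens_index r s).
  by exists (@mxtens_unindex r s); [exact: mxtens_indexK|exact: mxtens_unindexK].
split=> [/(opbound_reindex ib)|/(opbound_reindex hb)] aM u v.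
  have := aM u v; congr (is_true (rnorm _ <= _)); apply: eq_bigr => p _.
  by apply: eq_bigr => q _; rewrite mxE !mxtens_indexK.
have := aM u v; congr (is_true (rnorm _ <= _)); apply: eq_bigr => p _.
by apply: eq_bigr => q _; rewrite mxE.
Qed.

Lemma amplify_opnorm_le (X Y : Type) (m : X -> Y -> C) r s
    (x : 'M[X]_r) (y : 'M[Y]_s) M :
  0 <= M ->
  opbound (fun p q : 'I_r * 'I_s => m (x p.1 q.1) (y p.2 q.2)) M ->
  mx_opnorm (amplify m x y) <= M.
Proof. by move=> M0 /amplify_reindex; exact: mx_opnorm_le. Qed.

Lemma amplify_opbound (X Y : Type) (m : X -> Y -> C) r s (x : 'M[X]_r) (y : 'M[Y]_s) :
  opbound (fun p q : 'I_r * 'I_s => m (x p.1 q.1) (y p.2 q.2))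
    (mx_opnorm (amplify m x y)).
Proof. exact/amplify_reindex/mx_opnorm_bound. Qed.

Variables (X : normedModType C) (p : mxnorm R X).
Hypothesis pO : opspace p.

Lemma opspace0 n : p (0 : 'M[X]_n) = 0.
Proof.
have := os_normZ pO 0 (0 : 'M[X]_n); rewrite (rnorm0 _) mul0r => <-; congr (p _).
by apply/matrixP => i j; rewrite !mxE scaler0.
Qed.

Lemma opspace_ge0 n (x : 'M[X]_n) : 0 <= p x.
Proof.
have := os_normD pO x (map_mx (fun y => (-1) *: y) x).
rewrite (os_normZ pO) (_ : cabs (-1) = 1) ?mul1r; last by rewrite /rnorm normrN1.
rewrite (_ : x + _ = 0) ?opspace0 -?mulr2n ?pmulrn_lge0//.
by apply/matrixP => i j; rewrite !mxE scaleN1r subrr.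
Qed.

Lemma opspaceZ n (t : R) (x : 'M[X]_n) : 0 <= t ->
  p (map_mx (fun y => t%:C *: y) x) = t * p x.
Proof. by move=> t0; rewrite (os_normZ pO) rnorm_real. Qed.

Lemma opspace_bimod m n (a : 'M[C]_(m, n)) (x : 'M[X]_n) (b : 'M[C]_(n, m)) Ma Mb :
  0 <= Ma -> 0 <= Mb -> opbound (fun i j => a i j) Ma ->
  opbound (fun i j => b i j) Mb -> p (bimodule_mx a x b) <= Ma * p x * Mb.
Proof.
move=> Ma0 Mb0 aM bM; apply: le_trans (os_bimod pO _ _ _) _.
apply: ler_pM; rewrite ?mulr_ge0 ?mx_opnorm_ge0 ?opspace_ge0//.
  by rewrite ler_wpM2r ?opspace_ge0// mx_opnorm_le.
exact: mx_opnorm_le.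
Qed.

(** Compression by a row [u] and a column [v] lands in matrices of size [1], where [p] is the norm
    of [X]. *)
Lemma opspace_vector r (x : 'M[X]_r) (u v : 'I_r -> C) :
  rnorm (\sum_i \sum_j (u i * v j) *: x i j) <= vnorm u * p x * vnorm v.
Proof.
have := @opspace_bimod 1 r (\row_i u i) x (\col_j v j) (vnorm u) (vnorm v)
  (vnorm_ge0 _) (vnorm_ge0 _).
set y := \sum_i _; have -> : bimodule_mx (\row_i u i) x (\col_j v j) = const_mx y.
  apply/matrixP => i j; rewrite !mxE; apply: eq_bigr => k _.
  by apply: eq_bigr => l _; rewrite !mxE.
have -> : p (const_mx y : 'M[X]_1) = rnorm y.
  by apply: complexI; rewrite -rnormE -(os_level1 pO).
apply.
  rewrite (_ : vnorm u = hsnorm (fun i j => (\row_k u k) i j)); first exact: opbound_hs.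
  rewrite /hsnorm /vnorm sum_pair.
  by rewrite big_ord1; congr Num.sqrt; apply: eq_bigr => i _; rewrite mxE.
rewrite (_ : vnorm v = hsnorm (fun i j => (\col_k v k) i j)); first exact: opbound_hs.
rewrite /hsnorm /vnorm sum_pair.
by congr Num.sqrt; apply: eq_bigr => i _; rewrite big_ord1 mxE.
Qed.

Definition pairing n r (phi : 'M[dual X]_n) (x : 'M[X]_r)
    (q q' : 'I_n * 'I_r) : C :=
  phi q.1 q'.1 (x q.2 q'.2).

Lemma vnorm_slice (I J : finType) (u : I * J -> C) i :
  vnorm (fun j => u (i, j)) <= vnorm u.
Proof.
rewrite [leRHS]vnorm_prod /vnorm ler_sqrt; last first.
  by rewrite sumr_ge0// => k _; rewrite sqr_ge0.
rewrite [leRHS](bigD1 i)//= rnorm_real ?sqrtr_ge0// sqr_sqrtr; last first.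
  by rewrite sumr_ge0// => k _; rewrite sqr_ge0.
by rewrite lerDl sumr_ge0// => k _; rewrite sqr_ge0.
Qed.

Lemma bilin_pairing n r (phi : 'M[dual X]_n) (x : 'M[X]_r) u v :
  bilin (pairing phi x) u v =
  \sum_k \sum_l phi k l (\sum_i \sum_j (u (k, i) * v (l, j)) *: x i j).
Proof.
rewrite /bilin sum_pair; apply: eq_bigr => k _.
under eq_bigr do rewrite sum_pair.
rewrite exchange_big; apply: eq_bigr => l _.
rewrite (linearP_sum (dual_linear (phi k l))); apply: eq_bigr => i _.
rewrite (linearP_sum (dual_linear (phi k l))); apply: eq_bigr => j _.
by rewrite (linearP_Z (dual_linear (phi k l))) mulrAC.
Qed.

(** Far from sharp: it makes the supremum in [dual_mxnorm] finite and settles the case [p x = 0],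
    where rescaling is impossible. *)
Lemma pairing_bounded n r (phi : 'M[dual X]_n) (x : 'M[X]_r) :
  opbound (pairing phi x) ((\sum_k \sum_l rnorm (phi k l)) * p x).
Proof.
move=> u v; rewrite bilin_pairing.
apply: le_trans (rnorm_sum _ _ _) _; rewrite -!mulrA mulr_suml.
apply: ler_sum => k _; apply: le_trans (rnorm_sum _ _ _) _; rewrite mulr_suml.
apply: ler_sum => l _; apply: le_trans (rnorm_dual_le _ _) _.
rewrite ler_wpM2l ?rnorm_ge0//; apply: le_trans (opspace_vector _ _ _) _.
rewrite -mulrA mulrCA ler_wpM2l ?opspace_ge0// ler_pM ?vnorm_ge0//.
  exact: (vnorm_slice u).
exact: (vnorm_slice v).
Qed.

Lemma dual_mxnorm_has_sup n (phi : 'M[dual X]_n) :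
  has_sup [set t | exists r (x : 'M[X]_r),
    p x <= 1 /\ t = mx_opnorm (amplify (fun (f : dual X) y => f y : C) phi x)].
Proof.
split.
  by exists (mx_opnorm (amplify (fun (f : dual X) y => f y : C) phi (0 : 'M[X]_0))), 0%N, 0;
    rewrite opspace0 ler01.
have M0 : 0 <= \sum_k \sum_l rnorm (phi k l).
  by do 2 (apply: sumr_ge0 => ? _); exact: rnorm_ge0.
exists (\sum_k \sum_l rnorm (phi k l)) => _ [r [x [x1 ->]]].
apply: amplify_opnorm_le => //; apply: opbound_le (pairing_bounded phi x).
by rewrite ler_piMr.
Qed.

Lemma dual_mxnorm_le n (phi : 'M[dual X]_n) M : 0 <= M ->
  (forall r (x : 'M[X]_r), p x <= 1 -> opbound (pairing phi x) M) ->
  dual_mxnorm p phi <= M.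
Proof.
move=> M0 phiM; apply: ge_sup; first exact: (dual_mxnorm_has_sup phi).1.
by move=> _ [r [x [x1 ->]]]; apply: amplify_opnorm_le => //; exact: phiM.
Qed.

Lemma dual_mxnorm_ge0 n (phi : 'M[dual X]_n) : 0 <= dual_mxnorm p phi.
Proof.
apply: le_trans (ub_le_sup (dual_mxnorm_has_sup phi).2 _); last first.
  by exists 0%N, 0; rewrite opspace0 ler01.
exact: mx_opnorm_ge0.
Qed.

Lemma pairing_opbound n r (phi : 'M[dual X]_n) (x : 'M[X]_r) :
  opbound (pairing phi x) (dual_mxnorm p phi * p x).
Proof.
have [x0|x0] := eqVneq (p x) 0.
  rewrite x0 mulr0 => u v; have := pairing_bounded phi x u v.
  by rewrite x0 mulr0.
have xp : 0 < p x by rewrite lt_neqAle eq_sym x0 opspace_ge0.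
move=> u v; set y := map_mx (fun z => (p x)^-1%:C *: z) x.
have y1 : p y = 1 by rewrite opspaceZ ?mulVf// invr_ge0 ltW.
have : opbound (pairing phi y) (dual_mxnorm p phi).
  apply: opbound_le (amplify_opbound (fun (f : dual X) y => f y : C) phi y).
  apply: ub_le_sup; first exact: (dual_mxnorm_has_sup phi).2.
  by exists r, y; rewrite y1 lexx.
move=> /(_ u v).
have -> : bilin (pairing phi y) u v = (p x)^-1%:C * bilin (pairing phi x) u v.
  rewrite /bilin mulr_sumr; apply: eq_bigr => i _.
  rewrite mulr_sumr; apply: eq_bigr => j _.
  rewrite /pairing mxE (linearP_Z (dual_linear _)) -[_ *: _]/(_ * _).
  by rewrite [u i * _]mulrCA !mulrA.
have ipx : 0 <= (p x)^-1 by rewrite invr_ge0 ltW.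
rewrite rnormM (rnorm_real ipx) ler_pdivrMl//.
by rewrite !mulrA [p x * _]mulrC.
Qed.

End OperatorSpace.

(** * States on matrices *)

Section States.
Variable R : realType.
Local Notation C := R[i].
Local Notation cabs z := (rnorm (z : R[i]^o)).
Variable n : nat.
Implicit Types (A : 'I_n * 'I_n -> C^o) (xi : 'I_n -> C).

Definition hform A xi : R :=
  complex.Re (\sum_p A p * ((xi p.1)^*%C * xi p.2)).

Lemma Re_le_cabs (z : C) : complex.Re z <= cabs z.
Proof.
by rewrite -lecR cabsE; apply: le_trans (normc_ge_Re z); rewrite lecR ler_norm.
Qed.

Lemma hform_bound A xi : vnorm xi <= 1 -> hform A xi <= vnorm A.
Proof.
move=> xi1; apply: le_trans (Re_le_cabs _) _; apply: le_trans (dot_le _ _) _.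
rewrite (vnorm_tensor (fun i => (xi i)^*%C) xi) vnormJ.
by rewrite ler_piMr ?vnorm_ge0// mulr_ile1 ?vnorm_ge0.
Qed.

Definition lam A : R := sup [set hform A xi | xi in [set xi | vnorm xi <= 1]].

Lemma vnorm0 (I : finType) : vnorm (fun _ : I => 0 : C) = 0.
Proof. by rewrite /vnorm big1 ?sqrtr0// => i _; rewrite rnorm0 expr0n. Qed.

Lemma lam_has_sup A : has_sup [set hform A xi | xi in [set xi | vnorm xi <= 1]].
Proof.
split; last by exists (vnorm A) => _ [xi /= xi1 <-]; exact: hform_bound.
by exists (hform A (fun=> 0)), (fun=> 0) => //=; rewrite vnorm0 ler01.
Qed.

Lemma lam_ub A xi : vnorm xi <= 1 -> hform A xi <= lam A.
Proof. by move=> xi1; apply: ub_le_sup; [exact: (lam_has_sup A).2|exists xi]. Qed.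

Lemma lam_le A M : (forall xi, vnorm xi <= 1 -> hform A xi <= M) -> lam A <= M.
Proof.
by move=> AM; apply: ge_sup; [exact: (lam_has_sup A).1|move=> _ [xi /= ? <-]; exact: AM].
Qed.

Lemma hformD A A' xi : hform (A + A') xi = hform A xi + hform A' xi.
Proof.
rewrite /hform -raddfD -big_split /=; congr complex.Re; apply: eq_bigr => q _.
by rewrite -mulrDl.
Qed.

Lemma complexReMl (t : R) (z : C) : complex.Re (t%:C * z) = t * complex.Re z.
Proof. by case: z => a b /=; rewrite mul0r subr0. Qed.

Lemma hformZ (t : R) A xi : hform (t%:C *: A) xi = t * hform A xi.
Proof.
rewrite /hform -complexReMl mulr_sumr; congr complex.Re; apply: eq_bigr => q _.
by rewrite [RHS]mulrA.
Qed.

Lemma lam_sublinear : sublinear lam.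
Proof.
split=> [A A'|t A t0]; apply: lam_le => xi xi1.
  by rewrite hformD lerD// lam_ub.
by rewrite hformZ ler_wpM2l ?(ltW t0)// lam_ub.
Qed.

(** The product of [a] and its adjoint, as a function of index pairs. *)
Definition gram r (a : 'M[C]_(n, r)) (q : 'I_n * 'I_n) : C^o :=
  \sum_i a q.1 i * (a q.2 i)^*%C.

Lemma hform_gram r (a : 'M[C]_(n, r)) xi :
  hform (gram a) xi = vnorm (fun i => \sum_k (xi k)^*%C * a k i) ^+ 2.
Proof.
rewrite /hform (_ : \sum_p _ = (vnorm (fun i => \sum_k (xi k)^*%C * a k i) ^+ 2)%:C)//.
rewrite sqr_vnorm rmorph_sum sum_pair.
under eq_bigr do under eq_bigr do rewrite mulr_suml.
under eq_bigr do rewrite exchange_big.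
rewrite exchange_big; apply: eq_bigr => i _ /=.
rewrite sqr_cabs mulrC mulr_suml; apply: eq_bigr => j _.
rewrite rmorph_sum mulr_sumr; apply: eq_bigr => k _.
by rewrite rmorphM/= conjcK; ring.
Qed.

Lemma lam_gram_ge0 r (a : 'M[C]_(n, r)) : 0 <= lam (gram a).
Proof.
have := @lam_ub (gram a) (fun=> 0); rewrite vnorm0 ler01 hform_gram => /(_ isT).
exact/le_trans/sqr_ge0.
Qed.

(** The squared operator norm of [a] is the largest eigenvalue of [gram a]: for [xi] the normalised
    conjugate of [u], [hform (gram a) xi] is the squared norm of the row [u a] over that of [u]. *)
Lemma opbound_gram r (a : 'M[C]_(n, r)) :
  opbound (fun i j => a i j) (Num.sqrt (lam (gram a))).
Proof.
move=> u v.
have [u0|u0] := eqVneq (vnorm u) 0.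
  rewrite u0 mulr0 mul0r /bilin big1 ?rnorm0// => i _.
  by rewrite big1// => j _; rewrite (vnorm_eq0 i u0) !mul0r.
have up : 0 < vnorm u by rewrite lt_neqAle eq_sym u0 vnorm_ge0.
have -> : bilin (fun i j => a i j) u v = \sum_j (\sum_i u i * a i j) * v j.
  by rewrite /bilin exchange_big; apply: eq_bigr => j _; rewrite mulr_suml.
apply: le_trans (dot_le _ _) _; rewrite ler_wpM2r ?vnorm_ge0//.
pose xi i := (vnorm u)^-1%:C * (u i)^*%C.
have nV : cabs ((vnorm u)^-1%:C) = (vnorm u)^-1 by rewrite rnorm_real// invr_ge0 ltW.
have xi1 : vnorm xi <= 1 by rewrite vnormZ vnormJ nV mulVf.
have := lam_ub (gram a) xi1; rewrite hform_gram.
have -> : (fun i => \sum_k (xi k)^*%C * a k i) =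
    fun i => (vnorm u)^-1%:C * \sum_k u k * a k i.
  apply/funext => i; rewrite mulr_sumr; apply: eq_bigr => k _.
  by rewrite rmorphM/= conjcK oppr0 mulrA.
rewrite vnormZ nV => h; rewrite -ler_pdivrMr// mulrC -[leLHS]ger0_norm; last first.
  by rewrite mulr_ge0 ?vnorm_ge0 ?invr_ge0 ?ltW.
by rewrite -sqrtr_sqr ler_wsqrtr.
Qed.

Lemma lam_opp_gram r (a : 'M[C]_(n, r)) : lam (- gram a) <= 0.
Proof.
apply: lam_le => xi xi1; have := hformZ (-1) (gram a) xi.
rewrite rmorphN scaleN1r mulN1r => ->.
by rewrite oppr_le0 hform_gram sqr_ge0.
Qed.

Lemma lam_gram1 : lam (gram 1%:M) <= 1.
Proof.
apply: lam_le => xi xi1; rewrite hform_gram.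
have -> : (fun i => \sum_k (xi k)^*%C * (1%:M : 'M[C]_n) k i) = fun i => (xi i)^*%C.
  apply/funext => i; rewrite (bigD1 i)//= big1 ?addr0 ?mxE ?eqxx ?mulr1// => k ki.
  by rewrite mxE (negbTE ki) mulr0.
by rewrite vnormJ exprn_ile1 ?vnorm_ge0.
Qed.
End States.

(** The spectral theorem diagonalises [rho] by a unitary [U] with positive eigenvalues [D], and
    [w = D^(-1/2) U]. *)
Lemma posdef_unitary_form (F : numClosedFieldType) n (rho : 'M[F]_n) :
  rho^t* = rho ->
  (forall a : 'rV[F]_n, a != 0 -> 0 < (a *m rho *m a^t*) 0 0) ->
  exists2 w, w \in unitmx & w *m rho *m w^t* = 1%:M.
Proof.
move=> rhoH rho_gt0.
have /orthomx_spectral_subproof[[U D] /= Uu rhoE] : rho \is normalmx.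
  by apply/normalmxP; rewrite rhoH.
have Uunit := unitarymx_unit Uu.
have D0 k : 0 < D 0 k.
  have Uk : row k U != 0.
    apply/eqP => /(congr1 (fun x => x *m invmx U)); rewrite mul0mx -row_mul mulmxV//.
    by move=> /matrixP/(_ 0 k)/eqP; rewrite !mxE eqxx oner_eq0.
  have := rho_gt0 _ Uk; rewrite -row_mul.
  have -> : (row k (U *m rho) *m (row k U)^t*) 0 0 = (U *m rho *m U^t*) k k.
    by rewrite !mxE; apply: eq_bigr => j _; rewrite !mxE.
  have -> : U *m rho *m U^t* = diag_mx D.
    rewrite rhoE -(invmx_unitary Uu) !mulmxA mulmxV// mul1mx -mulmxA mulmxV//.
    by rewrite mulmx1.
  by rewrite mxE eqxx mulr1n.
pose E := diag_mx (map_mx (fun d => (sqrtC d)^-1) D).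
have EJ : E^t* = E.
  rewrite tr_diag_mx map_diag_mx; congr diag_mx; apply/rowP => k; rewrite !mxE.
  by apply/CrealP/ger0_real; rewrite invr_ge0 sqrtC_ge0 ltW.
have EDE : E *m diag_mx D *m E = 1%:M.
  rewrite !mulmx_diag -[1%:M]diag_const_mx; congr diag_mx; apply/rowP => k; rewrite !mxE.
  have k0 : sqrtC (D 0 k) != 0 by rewrite sqrtC_eq0 gt_eqF.
  by rewrite mulrAC -expr2 exprVn sqrtCK mulVf// gt_eqF.
exists (E *m U).
  by rewrite unitmx_mul Uunit andbT; move: EDE; rewrite -mulmxA => /mulmx1_unit[].
rewrite trmx_mul map_mxM/= EJ rhoE invmx_unitary// !mulmxA.
rewrite -[E *m U *m _]mulmxA (unitarymxP Uu) mulmx1.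
by rewrite -[_ *m U *m _]mulmxA (unitarymxP Uu) mulmx1.
Qed.

Section StateFactor.
Variable R : realType.
Local Notation C := R[i].
Local Notation cabs z := (rnorm (z : R[i]^o)).
Variable n : nat.

Lemma gram_mulmx_trace r (a : 'M[C]_(n, r)) (rho : 'M[C]_n) :
  \sum_q gram a q * rho q.1 q.2 = \tr (a^T *m rho *m map_mx (@conjc R) a).
Proof.
rewrite sum_pair /mxtrace.
under eq_bigr do under eq_bigr do rewrite mulr_suml.
under eq_bigr do rewrite exchange_big.
rewrite exchange_big; apply: eq_bigr => i _ /=; rewrite mxE.
rewrite exchange_big; apply: eq_bigr => k _ /=; rewrite mxE mulr_suml.
by apply: eq_bigr => j _; rewrite !mxE /=; ring.
Qed.

Lemma hsnorm_trace m r (x : 'M[C]_(m, r)) :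
  (hsnorm (fun i j => x i j) ^+ 2)%:C = \tr (x^T *m map_mx (@conjc R) x).
Proof.
rewrite /hsnorm sqr_vnorm rmorph_sum sum_pair exchange_big; apply: eq_bigr => j _.
rewrite mxE; apply: eq_bigr => i _; rewrite !mxE /= mulrC.
exact: sqr_cabs.
Qed.

(** [P] is the real part of the complex-linear [A |-> P A - i P (i A)], whose values on matrix units
    give [c]. *)
Lemma real_functional_density (P : ('I_n * 'I_n -> C^o) -> R) :
  (forall A B, P (A + B) = P A + P B) ->
  (forall (t : R) A, P (t%:C *: A) = t * P A) ->
  exists c : 'I_n * 'I_n -> C, forall A, P A = complex.Re (\sum_q A q * c q).
Proof.
move=> PD PZ; pose dl q : 'I_n * 'I_n -> C^o := fun p => (p == q)%:R.
exists (fun q => P (dl q) -i* P ('i%C *: dl q)) => A.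
have PZc (z : C) q : P (z *: dl q) = complex.Re (z * (P (dl q) -i* P ('i%C *: dl q))).
  rewrite [z in LHS]complexE scalerDl ['i%C * _]mulrC -scalerA PD !PZ.
  by case: z => a b /=; ring.
have P0 : P 0 = 0 by rewrite -(scale0r 0) (PZ 0) mul0r.
have AE : A = \sum_q (A q : C) *: dl q.
  apply/funext => p; rewrite fct_sumE.
  transitivity (\sum_q A q * (p == q)%:R : C); last by [].
  rewrite (bigD1 p)//= eqxx mulr1 big1 ?addr0// => q qp.
  by rewrite eq_sym (negbTE qp) mulr0.
rewrite [in LHS]AE.
have -> : P (\sum_q (A q : C) *: dl q) = \sum_q P ((A q : C) *: dl q).
  by elim/big_rec2: _ => [//|q y1 y2 _ <-]; exact: PD.
rewrite raddf_sum; apply: eq_bigr => q _; rewrite PZc; congr (complex.Re (_ * _)).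
Qed.

(* If h is the density matrix of P, then h + eps is positive definite, hence
   s^T (h + eps) conj(s) = 1 for some invertible s. *)
Lemma state_factor (P : ('I_n * 'I_n -> C^o) -> R) (eps : R) : 0 < eps ->
  (forall A B, P (A + B) = P A + P B) ->
  (forall (t : R) A, P (t%:C *: A) = t * P A) ->
  (forall A, P A <= lam A) ->
  exists s t : 'M[C]_n, [/\ s *m t = 1%:M,
    hsnorm (fun i j => t i j) ^+ 2 <= 1 + n%:R * eps &
    forall r (x : 'M[C]_(n, r)),
      P (gram (s *m x)) <= hsnorm (fun i j => x i j) ^+ 2].
Proof.
move=> e0 PD PZ Plam; have [c Pc] := real_functional_density PD PZ.
(* Gram matrices are hermitian, so passing to the hermitian part of [c] changes no value
   [P (gram a)] and makes the spectral theorem available. *)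
pose h : 'M[C]_n := \matrix_(i, j) ((c (i, j) + (c (j, i))^*%C) / 2).
pose rho : 'M[C]_n := h + eps%:C%:M.
have Pgram r (a : 'M[C]_(n, r)) : (P (gram a))%:C = \sum_q gram a q * h q.1 q.2.
  have -> : \sum_q gram a q * h q.1 q.2 =
      (\sum_q gram a q * c q + (\sum_q gram a q * c q)^*%C) / 2.
    rewrite [(_)^*%C]rmorph_sum.
    have -> : \sum_q (gram a q * c q)^*%C = \sum_q gram a q * (c (q.2, q.1))^*%C.
      rewrite !sum_pair exchange_big; apply: eq_bigr => i _; apply: eq_bigr => j _.
      rewrite rmorphM/=; congr (_ * _); rewrite rmorph_sum; apply: eq_bigr => k _.
      by rewrite rmorphM/= conjcK mulrC.
    rewrite -big_split mulr_suml; apply: eq_bigr => -[i j] _ /=.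
    by rewrite mxE -mulrDr mulrA.
  by rewrite Pc addcJ mulrC mulKf ?pnatr_eq0.
have rhoE r (a : 'M[C]_(n, r)) :
    (P (gram a) + eps * hsnorm (fun i j => a i j) ^+ 2)%:C =
    \tr (a^T *m rho *m map_mx (@conjc R) a).
  rewrite rmorphD rmorphM/= Pgram gram_mulmx_trace hsnorm_trace.
  rewrite mulmxDr mulmxDl mxtraceD mul_mx_scalar -scalemxAl mxtraceZ.
  by [].
have PN A : P (- A) = - P A.
  by rewrite -scaleN1r -(rmorph1 (real_complex R)) -rmorphN PZ mulN1r.
have Pgram_ge0 r (a : 'M[C]_(n, r)) : 0 <= P (gram a).
  rewrite -oppr_le0 -PN; apply: le_trans (Plam _) _; exact: lam_opp_gram.
have [||w wu wrho] := @posdef_unitary_form _ _ rho.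
- have hJ (x y : C) : (((x + y^*%C) / 2)^*%C) = (y + x^*%C) / 2.
    rewrite [LHS]rmorphM [X in X * _]rmorphD/= conjcK addrC.
    by congr (_ * _); rewrite -[RHS]conjcK conjc_inv conjc_nat.
  have eJ (b : bool) : (eps%:C *+ b)^*%C = eps%:C *+ b.
    by case: b; rewrite ?mulr1n ?mulr0n; [exact: conjc_real|exact: conjc0].
  apply/matrixP => i j; rewrite !mxE -[LHS]/((_ + _)^*%C) [LHS]rmorphD/= hJ eJ.
  by rewrite eq_sym.
- move=> a a0.
  have := rhoE _ a^T; rewrite trmxK /mxtrace big_ord1.
  rewrite -[map_mx (@conjc R) a^T]/(a^t*) => <-.
  rewrite ltcR ltr_wpDl// mulr_gt0// exprn_gt0// lt_neqAle vnorm_ge0 andbT eq_sym.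
  apply: contra a0 => /eqP a0; apply/eqP/rowP => j.
  by have := vnorm_eq0 (j, 0) a0; rewrite /= !mxE.
have wE : w *m rho *m map_mx (@conjc R) w^T = 1%:M by [].
have wJu : map_mx (@conjc R) w^T \in unitmx by rewrite map_unitmx unitmx_tr.
(* The squared Hilbert-Schmidt norm of the inverse is the trace of [rho], that is, [P] at the
   identity plus [n eps]. *)
exists w^T, (invmx w^T); rewrite mulmxV ?unitmx_tr//; split=> //.
  rewrite -lecR hsnorm_trace trmx_inv trmxK map_invmx.
  have -> : invmx w *m invmx (map_mx (@conjc R) w^T) = rho.
    by rewrite -[invmx w]mulmx1 -wE !mulmxA mulVmx// mul1mx mulmxK.
  have := rhoE _ 1%:M; rewrite trmx1 mul1mx map_mx1 mulmx1 => <-.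
  have -> : hsnorm (fun i j => (1%:M : 'M[C]_n) i j) ^+ 2 = n%:R.
    apply: complexI; rewrite hsnorm_trace trmx1 mul1mx map_mx1 mxtrace1.
    by rewrite rmorph_nat.
  rewrite lecR mulrC lerD2r; apply: le_trans (Plam _) _; exact: lam_gram1.
move=> r x; rewrite -lecR hsnorm_trace.
have -> : x^T *m map_mx (@conjc R) x =
    (w^T *m x)^T *m rho *m map_mx (@conjc R) (w^T *m x).
  rewrite trmx_mul trmxK map_mxM !mulmxA -[x^T *m w *m _]mulmxA.
  by rewrite -(mulmxA x^T) wE mulmx1.
by rewrite -rhoE lecR lerDl mulr_ge0 ?sqr_ge0// ltW.
Qed.
End StateFactor.

(** * The Effros-Ruan theorem *)

Section MatrixFunctional.
Variable R : realType.
Local Notation C := R[i].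
Local Notation cabs z := (rnorm (z : R[i]^o)).
Variables (X : normedModType C) (p : mxnorm R X).
Hypothesis pO : opspace p.
Variables (n : nat) (F : ('I_n * 'I_n -> X) -> C^o).
Hypotheses (lF : linear F)
  (Fp : forall w, cabs (F w) <= p (\matrix_(i, j) w (i, j))).

Definition sandwich r (a b : 'M[C]_(n, r)) (x : 'M[X]_r) : C :=
  F (fun q => bimodule_mx a x b^T q.1 q.2).

Lemma gram_row_mx r s (a : 'M[C]_(n, r)) (b : 'M[C]_(n, s)) :
  gram (row_mx a b) = gram a + gram b.
Proof.
apply/funext => q; rewrite /gram big_split_ord/=; congr (_ + _).
  by apply: eq_bigr => i _; rewrite !row_mxEl.
by apply: eq_bigr => i _; rewrite !row_mxEr.
Qed.

Lemma gramZ r (t : R) (a : 'M[C]_(n, r)) :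
  gram (t%:C *: a) = (t ^+ 2)%:C *: gram a.
Proof.
have tJ (z : C) : (t%:C * z)^*%C = t%:C * z^*%C.
  by rewrite [LHS]rmorphM; congr (_ * _); exact: conjc_real.
apply/funext => q; rewrite -[RHS]/((t ^+ 2)%:C * gram a q) /gram mulr_sumr.
by apply: eq_bigr => i _; rewrite !mxE tJ rmorphXn/=; ring.
Qed.

(** Together with [os_dsum], which keeps the direct sum in the unit ball, this makes the infimum in
    [dominating_states] subadditive. *)
Lemma sandwich_block r s (a b : 'M[C]_(n, r)) (a' b' : 'M[C]_(n, s))
    (x : 'M[X]_r) (y : 'M[X]_s) :
  sandwich (row_mx a a') (row_mx b b') (block_mx x 0 0 y) =
  sandwich a b x + sandwich a' b' y.
Proof.
rewrite /sandwich -(linearP_D lF); congr (F _); apply/funext => q.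
rewrite -[RHS]/(_ + _) !mxE big_split_ord/=; congr (_ + _).
  apply: eq_bigr => k _; rewrite big_split_ord/= [X in _ + X]big1 ?addr0.
    by apply: eq_bigr => l _; rewrite block_mxEul ![_^T _ _]mxE !row_mxEl.
  by move=> l _; rewrite block_mxEur [X in _ *: X]mxE scaler0.
apply: eq_bigr => k _; rewrite big_split_ord/= big1 ?add0r.
  by apply: eq_bigr => l _; rewrite block_mxEdr ![_^T _ _]mxE !row_mxEr.
by move=> l _; rewrite block_mxEdl [X in _ *: X]mxE scaler0.
Qed.

Lemma sandwichZ r (t : R) (a b : 'M[C]_(n, r)) (x : 'M[X]_r) :
  sandwich (t%:C *: a) (t%:C *: b) x = (t ^+ 2)%:C * sandwich a b x.
Proof.
rewrite /sandwich -[RHS](linearP_Z lF); congr (F _); apply/funext => q.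
rewrite -[RHS]/(_ *: _) !mxE scaler_sumr; apply: eq_bigr => k _.
rewrite scaler_sumr; apply: eq_bigr => l _; rewrite !mxE scalerA; congr (_ *: _).
by rewrite rmorphXn/=; ring.
Qed.

(** The bimodule axiom bounds the value by the product of the norms of [a] and [b]; twice a product
    is at most the sum of squares. *)
Lemma sandwich_le r (a b : 'M[C]_(n, r)) (x : 'M[X]_r) : p x <= 1 ->
  2 * complex.Re (sandwich a b x) <= lam (gram a) + lam (gram b).
Proof.
move=> x1.
suff H : complex.Re (sandwich a b x) <= Num.sqrt (lam (gram a)) * Num.sqrt (lam (gram b)).
  rewrite -(sqr_sqrtr (lam_gram_ge0 a)) -(sqr_sqrtr (lam_gram_ge0 b)).
  set u := Num.sqrt _ in H *; set v := Num.sqrt _ in H *.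
  have := sqr_ge0 (u - v); rewrite sqrrB; lra.
apply: le_trans (Re_le_cabs _) _; apply: le_trans (Fp _) _.
rewrite (_ : \matrix_(i, j) _ = bimodule_mx a x b^T); last first.
  by apply/matrixP => i j; rewrite mxE.
have bT : opbound (fun i j => b^T i j) (Num.sqrt (lam (gram b))).
  move=> u v; rewrite mulrAC (_ : bilin _ u v = bilin (fun i j => b i j) v u).
    exact: opbound_gram.
  rewrite /bilin exchange_big; apply: eq_bigr => i _; apply: eq_bigr => j _.
  by rewrite mxE; ring.
apply: le_trans (opspace_bimod pO x _ _ (@opbound_gram _ _ _ a) bT) _;
  rewrite ?sqrtr_ge0//.
by rewrite mulrAC ler_piMr ?mulr_ge0 ?sqrtr_ge0.
Qed.

Let V2 : lmodType C := (('I_n * 'I_n -> C^o) * ('I_n * 'I_n -> C^o))%type.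

(** All the estimates enter one sublinear functional on pairs of matrices, the infimum of [E]; a
    linear functional below it splits into [P] on the first component and [Q] on the second. *)
Lemma dominating_states : exists P Q : ('I_n * 'I_n -> C^o) -> R,
  [/\ [/\ forall A B, P (A + B) = P A + P B,
        forall (t : R) A, P (t%:C *: A) = t * P A & forall A, P A <= lam A],
      [/\ forall A B, Q (A + B) = Q A + Q B,
        forall (t : R) A, Q (t%:C *: A) = t * Q A & forall A, Q A <= lam A] &
      forall r (a b : 'M[C]_(n, r)) (x : 'M[X]_r), p x <= 1 ->
        2 * complex.Re (sandwich a b x) <= P (gram a) + Q (gram b)].
Proof.
have [lamD lamZ] := @lam_sublinear R n.
have lam0 : lam (0 : 'I_n * 'I_n -> C^o) = 0 := sublinear0 (@lam_sublinear R n).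
pose E (y : V2) := [set t : R | exists r (a b : 'M[C]_(n, r)) (x : 'M[X]_r),
  p x <= 1 /\ t = lam (y.1 + gram a) + lam (y.2 + gram b) -
    2 * complex.Re (sandwich a b x)].
have gram0 (a : 'M[C]_(n, 0)) : gram a = 0.
  by apply/funext => q; rewrite /gram big_ord0.
(* Empty [a], [b], [x] give the bound that will place [P] and [Q] below [lam]. *)
have E0 (y : V2) : E y (lam y.1 + lam y.2).
  exists 0%N, 0, 0, 0; split; first by rewrite (opspace0 pO) ler01.
  rewrite !gram0 !addr0 /sandwich (_ : (fun _ => _) = 0) ?(linearP_0 lF) ?mulr0 ?subr0//.
  by apply/funext => q; rewrite mxE big_ord0.
have hE (y : V2) : has_inf (E y).
  split; first by exists (lam y.1 + lam y.2).
  exists (- (lam (- y.1) + lam (- y.2))) => _ [r [a [b [x [x1 ->]]]]].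
  have := sandwich_le a b x1.
  have := lamD (- y.1) (y.1 + gram a); rewrite addKr.
  have := lamD (- y.2) (y.2 + gram b); rewrite addKr; lra.
have sE : sublinear (fun y => inf (E y)).
  apply: sublinear_inf => //.
    move=> y y' _ _ [r [a [b [x [x1 ->]]]]] [r' [a' [b' [x' [x1' ->]]]]].
    exists (lam ((y + y').1 + gram (row_mx a a')) + lam ((y + y').2 + gram (row_mx b b'))
      - 2 * complex.Re (sandwich (row_mx a a') (row_mx b b') (block_mx x 0 0 x'))).
      exists (r + r')%N, (row_mx a a'), (row_mx b b'), (block_mx x 0 0 x').
      by rewrite (os_dsum pO) ge_max x1 x1'.
    rewrite sandwich_block raddfD/= !gram_row_mx.
    rewrite (addrACA y.1 y'.1 (gram a)) (addrACA y.2 y'.2 (gram b)).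
    have := lamD (y.1 + gram a) (y'.1 + gram a').
    have := lamD (y.2 + gram b) (y'.2 + gram b'); lra.
  move=> t y _ t0 [r [a [b [x [x1 ->]]]]].
  (* [gram] and [sandwich] are quadratic in [a], [b], so scaling by [t] takes its square root. *)
  set s := Num.sqrt t; have ts : s ^+ 2 = t by rewrite sqr_sqrtr// ltW.
  exists (lam (t%:C *: y.1 + gram (s%:C *: a)) + lam (t%:C *: y.2 + gram (s%:C *: b))
    - 2 * complex.Re (sandwich (s%:C *: a) (s%:C *: b) x)).
    by exists r, (s%:C *: a), (s%:C *: b), x.
  rewrite sandwichZ !gramZ ts complexReMl -(scalerDr t%:C y.1) -(scalerDr t%:C y.2).
  have := lamZ t (y.1 + gram a) t0; have := lamZ t (y.2 + gram b) t0; lra.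
have [f [fD fZ fE]] := hahn_banach sE.
have fle y : f y <= lam y.1 + lam y.2.
  by apply: le_trans (fE y) _; apply: ge_inf; [exact: (hE y).2|].
exists (fun A => f (A, 0)), (fun A => f (0, A)); split; first split.
- by move=> A B; rewrite -fD; congr f; congr pair; rewrite addr0.
- by move=> t A; rewrite -fZ; congr f; congr pair; rewrite scaler0.
- by move=> A; apply: le_trans (fle _) _; rewrite lam0 addr0.
- split.
  + by move=> A B; rewrite -fD; congr f; congr pair; rewrite addr0.
  + by move=> t A; rewrite -fZ; congr f; congr pair; rewrite scaler0.
  + by move=> A; apply: le_trans (fle _) _; rewrite lam0 add0r.
move=> r a b x x1.
(* At this point both [lam] terms vanish and only the value of [F] remains. *)
have : f (- gram a, - gram b) <= - (2 * complex.Re (sandwich a b x)).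
  apply: le_trans (fE _) _; apply: ge_inf; first exact: (hE _).2.
  by exists r, a, b, x; rewrite !addNr lam0 !add0r.
have -> : (- gram a, - gram b) = (-1)%:C *: ((gram a, 0) + (0, gram b)) :> V2.
  rewrite rmorphN rmorph1 scaleN1r; congr pair.
    by rewrite -[LHS]addr0 -[0 in LHS]oppr0 -opprD.
  by rewrite -[LHS]add0r -[0 in LHS]oppr0 -opprD.
by rewrite fZ fD mulN1r lerN2.
Qed.

End MatrixFunctional.

Section EffrosRuan.
Variable R : realType.
Local Notation C := R[i].
Local Notation cabs z := (rnorm (z : R[i]^o)).

Lemma bilinZ (I J : finType) (a : I -> J -> C) k l u v :
  bilin a (fun i => k * u i) (fun j => l * v j) = k * l * bilin a u v.
Proof.
rewrite /bilin mulr_sumr; apply: eq_bigr => i _; rewrite mulr_sumr.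
by apply: eq_bigr => j _; ring.
Qed.

(** Normalising [u] and [v] and turning the phase of the form to [1] sharpens a sum of squares to a
    product of norms. *)
Lemma opbound_Re (I J : finType) (a : I -> J -> C) :
  (forall u v, 2 * complex.Re (bilin a u v) <= vnorm u ^+ 2 + vnorm v ^+ 2) ->
  opbound a 1.
Proof.
move=> aRe u v; rewrite mul1r.
have [u0|u0] := eqVneq (vnorm u) 0.
  rewrite u0 mul0r /bilin big1 ?rnorm0// => i _.
  by rewrite big1// => j _; rewrite (vnorm_eq0 i u0) !mul0r.
have [v0|v0] := eqVneq (vnorm v) 0.
  rewrite v0 mulr0 /bilin big1 ?rnorm0// => i _.
  by rewrite big1// => j _; rewrite (vnorm_eq0 j v0) mulr0.
have up : 0 < vnorm u by rewrite lt_neqAle eq_sym u0 vnorm_ge0.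
have vp : 0 < vnorm v by rewrite lt_neqAle eq_sym v0 vnorm_ge0.
set z := bilin a u v; have [->|z0] := eqVneq z 0.
  by rewrite rnorm0 mulr_ge0 ?vnorm_ge0.
have zp : 0 < cabs z by rewrite -ltcR cabsE normr_gt0.
have inv_abs (t : R) : 0 < t -> cabs (t^-1%:C) = t^-1.
  by move=> t0; rewrite rnorm_real// invr_ge0 ltW.
pose k := z^*%C * ((cabs z)^-1%:C * (vnorm u)^-1%:C); pose l := (vnorm v)^-1%:C : C.
have ku : vnorm (fun i => k * u i) = 1.
  rewrite vnormZ /k !rnormM cabsJ !inv_abs//; field.
  by rewrite u0 gt_eqF.
have lv : vnorm (fun j => l * v j) = 1.
  by rewrite vnormZ /l inv_abs// mulVf.
have := aRe (fun i => k * u i) (fun j => l * v j).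
rewrite bilinZ -/z ku lv expr1n (_ : k * l * z = (cabs z / (vnorm u * vnorm v))%:C).
  have -> : (1 + 1 : R) = 2 * 1 by rewrite mulr1.
  by rewrite ler_pM2l//= ler_pdivrMr ?mulr_gt0// mul1r.
transitivity (z^*%C * z * ((cabs z)^-1 * (vnorm u)^-1 * (vnorm v)^-1)%:C).
  by rewrite /k /l !rmorphM/=; ring.
rewrite -sqr_cabs -rmorphM/=; congr (_ %:C); field.
by rewrite u0 v0 gt_eqF.
Qed.

Variables (X : normedModType C) (p : mxnorm R X).
Hypothesis pO : opspace p.

(* The matrix norm of x is attained by F on M_n(X); F is dominated by a pair of
   states, and factoring their densities turns F into x |-> <phi x xi, eta> with
   phi completely contractive and xi, eta of norm almost 1. *)
Lemma mxnorm_le_dual n (x : 'M[X]_n) (M : R) : 0 <= M ->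
  (forall phi : 'M[dual X]_n, dual_mxnorm p phi <= 1 ->
    opbound (pairing phi x) M) ->
  p x <= M.
Proof.
move=> M0 xM; pose pw (w : 'I_n * 'I_n -> X) := p (\matrix_(i, j) w (i, j)).
have pw_seminorm : seminorm pw.
  split=> [w w'|k w].
    rewrite /pw (_ : \matrix_(i, j) _ =
        (\matrix_(i, j) w (i, j)) + \matrix_(i, j) w' (i, j)).
      exact: (os_normD pO).
    by apply/matrixP => i j; rewrite !mxE.
  rewrite /pw (_ : \matrix_(i, j) _ =
      map_mx (fun y => k *: y) (\matrix_(i, j) w (i, j))).
    by rewrite (os_normZ pO).
  by apply/matrixP => i j; rewrite !mxE.
have [F [lF Fp Fx]] := seminorm_functional (fun q => x q.1 q.2) pw_seminorm.
have {Fx} Fx : F (fun q => x q.1 q.2) = (p x)%:C.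
  by rewrite Fx; congr (p _)%:C; apply/matrixP => i j; rewrite mxE.
have [P [Q [[PD PZ Pl] [QD QZ Ql] PQ]]] := dominating_states pO lF Fp.
apply/ler_addgt0Pr => e e0.
(* Chosen so that [M (1 + n eps) <= M + e]; the summand [1] covers [M = 0]. *)
pose eps := e / (n%:R * M + 1).
have nM : 0 < n%:R * M + 1 by rewrite ltr_wpDl// mulr_ge0.
have eps0 : 0 < eps by rewrite divr_gt0.
have [s [t [st tn Ps]]] := state_factor eps0 PD PZ Pl.
have [s' [t' [st' tn' Qs]]] := state_factor eps0 QD QZ Ql.
(* [F] at the matrix with [y] at entry [(k, l)], multiplied by [s] on the left and by the transpose
   of [s'] on the right. *)
pose f k l (y : X) : C^o := F (fun q => (s q.1 k * s' q.2 l) *: y).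
have lf k l : linear (f k l).
  move=> c y z; rewrite /f -lF; congr (F _); apply/funext => q.
  by rewrite scalerDr -[RHS]/(_ *: (_ *: _) + _ *: _) !scalerA [c * _]mulrC.
pose Ma k := hsnorm (fun i j => (col k s) i j).
pose Mb l := hsnorm (fun i j => (col l s')^T i j).
have fM k l y : `|f k l y| <= (Ma k * Mb l)%:C * `|y|.
  rewrite !rnormE -rmorphM/= lecR; apply: le_trans (Fp _) _.
  rewrite /pw (_ : \matrix_(i, j) _ =
      bimodule_mx (col k s) (const_mx y : 'M[X]_1) (col l s')^T).
    rewrite mulrAC (_ : rnorm y = p (const_mx y : 'M[X]_1)).
      by apply: opspace_bimod; rewrite ?vnorm_ge0//; exact: opbound_hs.
    by apply: complexI; rewrite (os_level1 pO) rnormE.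
  by apply/matrixP => i j; rewrite !mxE !big_ord1 !mxE.
have MM0 k l : 0 <= (Ma k * Mb l)%:C by rewrite ler0c mulr_ge0 ?vnorm_ge0.
pose phi : 'M[dual X]_n := \matrix_(k, l) mkdual (MM0 k l) (lf k l) (fM k l).
have phiE r (y : 'M[X]_r) u v : bilin (pairing phi y) u v =
    sandwich F (s *m \matrix_(k, i) u (k, i)) (s' *m \matrix_(l, j) v (l, j)) y.
  rewrite bilin_pairing.
  transitivity (\sum_k \sum_l f k l (\sum_i \sum_j (u (k, i) * v (l, j)) *: y i j)).
    by apply: eq_bigr => k _; apply: eq_bigr => l _; rewrite mxE.
  rewrite /f /sandwich.
  under eq_bigr do rewrite -(linearP_sum lF).
  rewrite -(linearP_sum lF); congr (F _); apply/funext => q; rewrite mxE fct_sumE.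
  under eq_bigr do rewrite fct_sumE.
  under eq_bigr do under eq_bigr do rewrite scaler_sumr.
  under eq_bigr do rewrite exchange_big.
  rewrite exchange_big; apply: eq_bigr => i _.
  under eq_bigr do under eq_bigr do rewrite scaler_sumr.
  under eq_bigr do rewrite exchange_big.
  rewrite exchange_big; apply: eq_bigr => j _.
  rewrite ![_^T _ _]mxE !mxE mulr_suml scaler_suml; apply: eq_bigr => k _.
  rewrite mulr_sumr scaler_suml; apply: eq_bigr => l _.
  by rewrite !mxE scalerA; congr (_ *: _); ring.
have hsE r (u : 'I_n * 'I_r -> C) :
    hsnorm (fun i j => (\matrix_(k, i) u (k, i)) i j) = vnorm u.
  by congr vnorm; apply/funext => -[i j]; rewrite mxE.
(* The states dominate the pairing by [P (gram (s u)) + Q (gram (s' v))], and the factorisations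
   bound these terms by the squared norms of [u] and [v]. *)
have phi1 : dual_mxnorm p phi <= 1.
  apply: (dual_mxnorm_le pO ler01) => r y y1; apply: opbound_Re => u v.
  rewrite phiE; apply: le_trans (PQ _ _ _ _ y1) _.
  by rewrite -!hsE lerD.
(* The entries of [t] and [t'] serve as test vectors: they cancel [s] and [s'] and return [F] at
   [x]. *)
have := xM phi phi1 (fun q => t q.1 q.2) (fun q => t' q.1 q.2).
rewrite phiE (_ : \matrix_(k, i) _ = t); last by apply/matrixP => i j; rewrite mxE.
rewrite (_ : \matrix_(k, i) _ = t'); last by apply/matrixP => i j; rewrite mxE.
rewrite st st' /sandwich (_ : (fun _ => _) = fun q => x q.1 q.2); last first.
  apply/funext => q; rewrite mxE (bigD1 q.1)//= [X in _ + X]big1 ?addr0; last first.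
    by move=> k kq; rewrite big1// => l _; rewrite mxE eq_sym (negbTE kq) mul0r scale0r.
  rewrite (bigD1 q.2)//= big1 ?addr0; last first.
    by move=> l lq; rewrite !mxE [q.2 == l]eq_sym (negbTE lq) mulr0 scale0r.
  by rewrite !mxE !eqxx mul1r scale1r.
rewrite Fx rnorm_real ?opspace_ge0// => /le_trans; apply.
have tt :
    vnorm (fun q => t q.1 q.2) * vnorm (fun q => t' q.1 q.2) <= 1 + n%:R * eps.
  have := sqr_ge0 (vnorm (fun q => t q.1 q.2) - vnorm (fun q => t' q.1 q.2)).
  by move: tn tn'; rewrite /hsnorm sqrrB; lra.
rewrite -mulrA; apply: le_trans (ler_wpM2l M0 tt) _.
have eE : eps * (n%:R * M + 1) = e by rewrite divfK// gt_eqF.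
by rewrite -eE mulrDr mulr1 lerD2l mulrDr mulr1 mulrA mulrC [M * _]mulrC lerDl ltW.
Qed.

End EffrosRuan.

(** * Completely contractive Banach algebras *)

Lemma opbound_eq (R : realType) (I J : finType) (a b : I -> J -> R[i]) M :
  (forall i j, a i j = b i j) -> opbound a M -> opbound b M.
Proof.
move=> ab aM u v; have := aM u v; congr (is_true (rnorm _ <= _)).
by apply: eq_bigr => i _; apply: eq_bigr => j _; rewrite ab.
Qed.

Lemma swap_bij (I J : Type) : bijective (fun z : I * J => (z.2, z.1)).
Proof. by exists (fun z => (z.2, z.1)); case. Qed.

Lemma mxtens_index_bij m n : bijective (@mxtens_index m n).
Proof.
by exists (@mxtens_unindex m n); [exact: mxtens_indexK|exact: mxtens_unindexK].
Qed.

Lemma mxtens_unindex_bij m n : bijective (@mxtens_unindex m n).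
Proof.
by exists (@mxtens_index m n); [exact: mxtens_unindexK|exact: mxtens_indexK].
Qed.

(** The index shuffle of the right action, with [I], [J], [M] indexing [x], [a] and the test matrix:
    the last two join into one product. *)
Lemma reassoc_bij (I J K M L : Type) (f : K -> I * J) (g : J * M -> L) :
  bijective f -> bijective g ->
  bijective (fun z : M * K => (g ((f z.2).2, z.1), (f z.2).1)).
Proof.
move=> [f' fK f'K] [g' gK g'K].
exists (fun w => ((g' w.1).2, f' (w.2, (g' w.1).1))) => -[k m] /=.
  by rewrite gK/= -surjective_pairing fK.
by rewrite f'K/= -surjective_pairing g'K.
Qed.

(** The counterpart for the square action: the index of the test matrix joins that of [mu], and the
    order is kept. *)
Lemma assoc_bij (I J K M L : Type) (f : K -> I * J) (g : M * I -> L) :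
  bijective f -> bijective g ->
  bijective (fun z : M * K => (g (z.1, (f z.2).1), (f z.2).2)).
Proof.
move=> [f' fK f'K] [g' gK g'K].
exists (fun w => ((g' w.1).1, f' ((g' w.1).2, w.2))) => -[k m] /=.
  by rewrite gK/= -surjective_pairing fK.
by rewrite f'K/= -surjective_pairing g'K.
Qed.

Section Transport.
Variable R : realType.
Local Notation C := R[i].
Variables (X Y : normedModType C) (Q : X -> Y) (p : mxnorm R Y).
Hypotheses (lQ : linear Q) (Qsurj : forall y, exists x, Q x = y)
  (nQ : forall x, rnorm (Q x) = rnorm x) (pO : opspace p).

Definition transport_mxnorm : mxnorm R X := fun n x => p (map_mx Q x).

Lemma transport_opspace : opspace transport_mxnorm.
Proof.
split=> [x|n x y|n k x|n x px0|m n x y|m n a x b]; rewrite /transport_mxnorm.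
- by rewrite map_const_mx (os_level1 pO) !rnormE nQ.
- rewrite (_ : map_mx Q (x + y) = map_mx Q x + map_mx Q y); first exact: (os_normD pO).
  by apply/matrixP => i j; rewrite !mxE (linearP_D lQ).
- rewrite -(os_normZ pO); congr (p _); apply/matrixP => i j.
  by rewrite !mxE (linearP_Z lQ).
- apply/matrixP => i j; rewrite mxE; apply: rnorm_eq0; rewrite -nQ.
  by have /matrixP/(_ i j) := os_norm0 pO px0; rewrite !mxE => ->; rewrite rnorm0.
- rewrite map_block_mx -(os_dsum pO); congr (p (block_mx _ _ _ _));
    by apply/matrixP => i j; rewrite !mxE (linearP_0 lQ).
rewrite (_ : map_mx Q _ = bimodule_mx a (map_mx Q x) b); first exact: (os_bimod pO).
apply/matrixP => i j; rewrite !mxE (linearP_sum lQ); apply: eq_bigr => k _.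
rewrite (linearP_sum lQ); apply: eq_bigr => l _.
by rewrite mxE (linearP_Z lQ).
Qed.

Lemma map_mx_surj n (y : 'M[Y]_n) : exists x, map_mx Q x = y.
Proof.
exists (\matrix_(i, j) projT1 (cid (Qsurj (y i j)))).
by apply/matrixP => i j; rewrite !mxE; exact: (projT2 (cid (Qsurj (y i j)))).
Qed.

(** Through [Q] the matrix unit balls of [X] and [Y] correspond at every size, so both suprema run
    over the same set. *)
Lemma dual_mxnorm_transport (q : mxnorm R X) n
    (mu : 'M[dual X]_n) (nu : 'M[dual Y]_n) :
  (forall r (x : 'M[X]_r), q r x = p (map_mx Q x)) ->
  (forall i j x, mu i j x = nu i j (Q x)) ->
  dual_mxnorm q mu = dual_mxnorm p nu.
Proof.
move=> qp munu; congr sup.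
have ampE r (x : 'M[X]_r) : amplify (fun (f : dual X) y => f y : C) mu x =
    amplify (fun (f : dual Y) y => f y : C) nu (map_mx Q x).
  by apply/matrixP => i j; rewrite !mxE munu.
apply/seteqP; split=> _ [r [x [x1 ->]]].
  by exists r, (map_mx Q x); rewrite -qp -ampE.
have [y yx] := map_mx_surj x.
by exists r, y; rewrite qp ampE yx.
Qed.

End Transport.

Section OperatorRepresents.
Variables (R : realType) (A : ccBanachAlg R) (B : opDualAlgOver A).
Hypothesis ohB : op_HLDBA B.
Local Notation C := R[i].
Local Notation P := (predual B).
Let pm : mxnorm R P := @op_mx R A B.
Let hB : HLDBA B := ohl_HLDBA ohB.
Let pO : opspace pm := ohl_mxP ohB.

Section Given.
Variables (S : banachSubspace (dual A)) (Q : S -> P).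
Hypothesis SQ : @represents R A B S Q.
Let q : mxnorm R S := transport_mxnorm Q pm.

Lemma represents_opspace : opspace q.
Proof. by case: SQ => lQ _ nQ _; exact: transport_opspace. Qed.

(** Up to swapping the tensor factors, [x] on a matrix [a] is the pairing of the image of [a] under
    [deta B] with [Q x]; complete contractivity of [deta B] then applies. *)
Lemma represents_cc_val : cc q (dual_mxnorm (@cc_mx R A)) (@bs_val R _ S).
Proof.
move=> n x; apply: (dual_mxnorm_le (cc_mxP A)) => [|r a a1].
  exact: (opspace_ge0 represents_opspace).
have le_q : dual_mxnorm pm (map_mx (@deta R A B) a) * pm (map_mx Q x) <= q x.
  by rewrite ler_piMl ?(opspace_ge0 pO)//; exact: le_trans (ohl_eta ohB a) a1.
apply: opbound_eq (opbound_le le_q 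
  (opbound_reindex (@swap_bij _ _) (pairing_opbound pO _ _))).
by move=> i j; rewrite /pairing !mxE; case: SQ => _ _ _ ->.
Qed.

(** A test matrix [phi] over the dual of [P] turns the left side into the pairing of [Q x] with an
    amplified product in the algebra, which [ohl_mul] bounds. *)
Lemma represents_cc_act (Sact : act_closed S) :
  cc2 q (@cc_mx R A) q (sub_act Sact).
Proof.
move=> r s x a; apply: (mxnorm_le_dual pO) => [|phi phi1].
  by rewrite mulr_ge0 ?(opspace_ge0 pO)// (opspace_ge0 (cc_mxP A)).
set psi := amplify (@dmul R A B) (map_mx (@deta R A B) a) phi.
have le_q : dual_mxnorm pm psi * pm (map_mx Q x) <= q x * cc_mx a.
  rewrite mulrC ler_wpM2l ?(opspace_ge0 pO)//.
  apply: le_trans (ohl_mul ohB _ _) _; rewrite -[leRHS]mulr1.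
  apply: ler_pM; rewrite ?(dual_mxnorm_ge0 pO)//.
  exact: (ohl_eta ohB).
have hb := reassoc_bij (@mxtens_unindex_bij r s) (@mxtens_index_bij s (r * s)).
apply: opbound_eq (opbound_le le_q (opbound_reindex hb (pairing_opbound pO _ _))).
move=> i j; rewrite /pairing mxE !mxtens_indexK [in RHS]mxE !mxE.
by rewrite (represents_act hB SQ).
Qed.

Lemma represents_dual_mx n (mu : 'M[dual S]_n) :
  exists2 nu : 'M[dual P]_n, (forall i j s, mu i j s = nu i j (Q s)) &
    dual_mxnorm pm nu = dual_mxnorm q mu.
Proof.
have nuP i j : exists nu : dual P, forall s, mu i j s = nu (Q s).
  by have [nu munu _] := represents_dual SQ (mu i j); exists nu.
exists (\matrix_(i, j) projT1 (cid (nuP i j))) => [i j s|].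
  by rewrite mxE; exact: (projT2 (cid (nuP i j))).
case: SQ => _ Qs _ _; symmetry; apply: (dual_mxnorm_transport Qs) => // i j s.
by rewrite mxE; exact: (projT2 (cid (nuP i j))).
Qed.

(** The same test; the amplified product is now that of [phi] with [nu], the matrix over the dual of
    [P] that corresponds to [mu]. *)
Lemma represents_cc_box (Sact : act_closed S) (Sactn : contractive2 (sub_act Sact))
    (Sbox : box_closed Sactn) :
  cc2 (dual_mxnorm q) q q (sub_box Sbox).
Proof.
move=> r s mu x; have [nu munu <-] := represents_dual_mx mu.
apply: (mxnorm_le_dual pO) => [|phi phi1].
  by rewrite mulr_ge0 ?(opspace_ge0 pO)// (dual_mxnorm_ge0 pO).
set psi := amplify (@dmul R A B) phi nu.
have le_q : dual_mxnorm pm psi * pm (map_mx Q x) <= dual_mxnorm pm nu * q x.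
  rewrite ler_wpM2r ?(opspace_ge0 pO)//.
  apply: le_trans (ohl_mul ohB _ _) _; rewrite -[leRHS]mul1r.
  by apply: ler_pM; rewrite ?(dual_mxnorm_ge0 pO).
have hb := assoc_bij (@mxtens_unindex_bij r s) (@mxtens_index_bij (r * s) r).
apply: opbound_eq (opbound_le le_q (opbound_reindex hb (pairing_opbound pO _ _))).
move=> i j; rewrite /pairing mxE !mxtens_indexK [in RHS]mxE !mxE.
by rewrite (represents_box hB SQ _ _ _ (munu _ _)).
Qed.

End Given.

Lemma exists_op_introverted_represents :
  exists (S : op_introverted A) (Q : S -> P), @represents R A B S Q /\
    forall n (x : 'M[S]_n), oin_mx x = pm (map_mx Q x).
Proof.
have [S [Q SQ]] := exists_introverted_represents hB.
have Sbox := represents_cc_box SQ (@in_box R A S).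
by exists (OpIntroverted (represents_opspace SQ) (represents_cc_val SQ)
  (represents_cc_act SQ (@in_act R A S)) Sbox), Q.
Qed.

Lemma op_represents_equiv (S : op_introverted A) (Q : S -> P) :
  @represents R A B S Q -> (forall n (x : 'M[S]_n), oin_mx x = pm (map_mx Q x)) ->
  op_hldba_equiv B (op_arensAlg S).
Proof.
move=> SQ Sq; have [Phi [iPhi PhiE]] := represents_iso hB SQ.
exists Phi; split=> // n nu; case: SQ => _ Qs _ _.
by apply: (dual_mxnorm_transport Qs) => // i j s; rewrite mxE PhiE.
Qed.

(** The equivalence preserves dual matrix norms only, so [mxnorm_le_dual] is applied once over [S]
    and once over [P]; over [S] the test matrices are first lifted through the surjective [Phi]. *)
Lemma op_equiv_represents (S : op_introverted A) :
  op_hldba_equiv B (op_arensAlg S) ->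
  exists Q : S -> P, @represents R A B S Q /\
    forall n (x : 'M[S]_n), oin_mx x = pm (map_mx Q x).
Proof.
move=> [Phi [iPhi nPhi]]; have [Q SQ PhiE] := iso_represents iPhi.
exists Q; split=> // n x; have sO := @oin_mxP R A S.
have {}nPhi m (psi : 'M[dual P]_m) :
  dual_mxnorm (@oin_mx R A S) (map_mx Phi psi) = dual_mxnorm pm psi := nPhi m psi.
have pairingE m (psi : 'M[dual P]_m) i j :
    pairing psi (map_mx Q x) i j = pairing (map_mx Phi psi) x i j.
  by rewrite /pairing !mxE PhiE.
apply: le_anti; apply/andP; split.
  apply: (mxnorm_le_dual sO) => [|phi phi1]; first exact: (opspace_ge0 pO).
  have [psi psiE] : exists psi, map_mx Phi psi = phi.
    apply: map_mx_surj => mu.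
    have [nu _ <-] : range Phi mu by rewrite (iso_surj iPhi).
    by exists nu.
  apply: (opbound_eq (a := pairing psi (map_mx Q x))).
    by move=> i j; rewrite pairingE psiE.
  apply: opbound_le (pairing_opbound pO _ _).
  by rewrite ler_piMl ?(opspace_ge0 pO)//; move: phi1; rewrite -psiE nPhi.
apply: (mxnorm_le_dual pO) => [|psi psi1]; first exact: (opspace_ge0 sO).
apply: (opbound_eq (a := pairing (map_mx Phi psi) x)) => [i j|].
  by rewrite pairingE.
apply: opbound_le (pairing_opbound sO _ _).
by rewrite ler_piMl ?(opspace_ge0 sO)//; rewrite nPhi.
Qed.

Lemma op_hldba_unique_arens :
  exists! S : op_introverted A, op_hldba_equiv B (op_arensAlg S).
Proof.
have [S [Q [SQ Sq]]] := exists_op_introverted_represents.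
exists S; split; first exact: op_represents_equiv SQ Sq.
move=> S' /op_equiv_represents[Q' [SQ' Sq']].
apply: op_introverted_ext; first exact: (represents_mem_eq SQ SQ').
move=> n x y xy; rewrite Sq Sq'; congr (pm _); apply/matrixP => i j; rewrite !mxE.
apply: (represents_eq hB SQ SQ').
by have /matrixP/(_ i j) := xy; rewrite !mxE.
Qed.

End OperatorRepresents.

Theorem theorem3p4 (R : realType) :
  (forall (A : banachAlg R) (B : dualAlgOver A), HLDBA B ->
     exists! S : introverted A, hldba_equiv B (arensAlg S))
  /\
  (forall (A : ccBanachAlg R) (B : opDualAlgOver A), op_HLDBA B ->
     exists! S : op_introverted A, op_hldba_equiv B (op_arensAlg S)).
Proof.
by split=> A B hB; [exact: hldba_unique_arens|exact: op_hldba_unique_arens].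
Qed.
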